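(* In the abstract setting of the context, assume (H1)-(H7) and, in addition, $-a<\frac{(d_0\gamma^-)^2}{2}$. Let $(c^\star,\mathbf U)$ be the solution given by the existence theorem recalled in the context. Then $\gamma^->c^\star$, and there exists $M^->0$ such that for all $t\in\mathbb R$ $$\|\mathbf U(t)-\mathbf v^-(\mathbf U)\|_L\le M^-e^{(\gamma^--c^\star)t}$$ for some $\mathbf v^-(\mathbf U)\in F^-$.
   Context: Setting. $L$ is a Hilbert space (norm $\|\cdot\|_L$), $H\subset L$ is a Hilbert space with its own norm $\|\cdot\|_H$, $\mathcal E:L\to(-\infty,+\infty]$, and $F^-,F^+\subset L$. $\mathrm{dist}_L(v,F)=\inf_{f\in F}\|v-f\|_L$, $\mathrm{dist}_H$ likewise. For $r>0$, $F^\pm_r=\{v\in L:\mathrm{dist}_L(v,F^\pm)\le r\}$ and $F^\pm_{H,r}=\{v\in H:\mathrm{dist}_H(v,F^\pm)\le r\}$. Conditions with $\pm$ are required for both signs. (H1) $\mathcal E$ is weakly lower semicontinuous in $L$; $F^\pm$ are closed in $L$; there is $a<0$ with $\mathcal E(v)\ge\mathcal E(f)=a$ for all $v\in L$, $f\in F^-$; each $f\in F^+$ is a local minimizer of $\mathcal E$ with $\mathcal E(f)=0$. Write $a^-:=a$, $a^+:=0$. There are $r_0^\pm>0$ with $F^+_{r_0^+}\cap F^-_{r_0^-}=\emptyset$ and $C^\pm>1$ with $(C^\pm)^{-1}\mathrm{dist}_L(v,F^\pm)^2\le\mathcal E(v)-a^\pm$ for all $v\in F^\pm_{r_0^\pm}$.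 For every $v\in F^\pm_{r_0^\pm}$ there is a unique $P^\pm(v)\in F^\pm$ with $\|v-P^\pm(v)\|_L=\mathrm{dist}_L(v,F^\pm)$, and $P^\pm:F^\pm_{r_0^\pm}\to F^\pm$ is $C^2$ for the $L$-norm. (H2) $H=\{v\in L:\mathcal E(v)<+\infty\}$, $\|\cdot\|_L\le\|\cdot\|_H$ (in particular $F^\pm\subset H$), $\mathcal E$ is $C^1$ on $(H,\|\cdot\|_H)$ with differential $D\mathcal E$. There is a smaller space $\tilde H\subset H$ with an inner product and norm $\|\cdot\|_{\tilde H}\ge\|\cdot\|_H$ and a continuous map $D_L\mathcal E:(\tilde H,\|\cdot\|_{\tilde H})\to(L,\|\cdot\|_L)$ with $\langle D_L\mathcal E(v),w\rangle_L=D\mathcal E(v)(w)$ for all $v\in\tilde H$, $w\in H$. (H3) $L$-bounded subsets of $F^\pm$ are relatively compact with respect to $H$-convergence. (H4) For each sign, either $F^\pm$ is $L$-bounded, or: for all $(v,f)\in F^\pm_{r_0^\pm}\times F^\pm$ there is an associated map $\hat P=\hat P^\pm_{(v,f)}:L\to L$ which, at the point $v$, satisfies $P^\pm(\hat P(v))=f$, $\mathrm{dist}_L(\hat P(v),F^\pm)=\mathrm{dist}_L(v,F^\pm)$ and $\mathcal E(\hat P(v))=\mathcal E(v)$, and which is differentiable on $L$ with $\|D\hat P(w_1)w_2\|_L=\|w_2\|_L$ for all $w_1,w_2\in L$. (H5) For every $v\in F^\pm_{H,r_0^\pm}$ there is a unique $P_H^\pm(v)\in F^\pm$ with $\|v-P_H^\pm(v)\|_H=\mathrm{dist}_H(v,F^\pm)$;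 $P_H^\pm$ is $C^1$ for the $H$-norm. With $C^\pm$ from (H1), for all $v\in F^\pm_{H,r_0^\pm}$: $\|P^\pm(v)-P_H^\pm(v)\|_H\le C^\pm\|v-P_H^\pm(v)\|_H$ and $(C^\pm)^{-2}\|v-P_H^\pm(v)\|_H^2\le\mathcal E(v)-a^\pm\le(C^\pm)^2\|v-P_H^\pm(v)\|_H^2$. For each $r\in(0,r_0^\pm]$ there is a constant $\beta^\pm(r)>0$ (fixed) such that $v\in F^\pm_{r_0^\pm}$ and $\mathcal E(v)\le a^\pm+\beta^\pm(r)$ imply $v\in F^\pm_{H,r}$. Weighted energy. For a non-empty interval $I$, $c>0$, $U\in H^1_{loc}(I,L)$: $\mathbf E_c(U;I)=\int_I\big[\tfrac12\|U'(t)\|_L^2+\mathcal E(U(t))\big]e^{ct}dt$ and $\mathbf E_c(U)=\mathbf E_c(U;\mathbb R)$. $U$ is a local minimizer of $\mathbf E_c(\cdot;I)$ if $\mathbf E_c(U;I)$ is well defined and finite and there is $C>0$ such that for every $\phi\in\mathcal C^1_c(\mathrm{int}(I),(H,\|\cdot\|_H))$ with $\max_I\|\phi(t)\|_H<C$, $\mathbf E_c(U+\phi;I)$ is well defined and not smaller than $\mathbf E_c(U;I)$. For $O\subset\mathbb R$ open, $\mathcal A(O)=\mathcal C^2_{loc}(O,L)\cap\mathcal C^1_{loc}(O,(H,\|\cdot\|_H))\cap\mathcal C^0_{loc}(O,(\tilde H,\|\cdot\|_{\tilde H}))$. (H6) There is $\mathfrak P:L\to L$ such that for all $v,v_1,v_2\in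 L$: $\mathcal E(\mathfrak P(v))\le\mathcal E(v)$, with equality iff $\mathfrak P(v)=v$; $\|\mathfrak P(v_1)-\mathfrak P(v_2)\|_L\le\|v_1-v_2\|_L$; and $\mathfrak P$ is the identity on $F^-\cup F^+$. If $I\subset\mathbb R$ is a non-empty (possibly unbounded) open interval, $c>0$, and $\mathbf W\in H^1_{loc}(I,L)$ is a local minimizer of $\mathbf E_c(\cdot;I)$ with $\mathbf W(t)=\mathfrak P(\mathbf W(t))$ for all $t\in I$, then $\mathbf W\in\mathcal A(I)$ and $\mathbf W''-D_L\mathcal E(\mathbf W)=-c\mathbf W'$ in $I$. Constants. $\kappa^-_r=\inf\{\mathcal E(v):\mathrm{dist}_L(v,F^-)\in[r,r_0^-]\}$ for $r\in(0,r_0^-]$; $\eta_0^-=\min\{\sqrt{e^{-1}\frac{r_0^-}{4}\sqrt{2(\kappa^-_{r_0^-/4}-a)}},\frac{r_0^-}{4}\}$; $\hat r^-=\frac{r_0^-}{C^-+1}$; $$\mathcal E^-_{\max}=\frac{1}{(C^-)^2(C^-+1)}\min\Big\{\tfrac{(\eta_0^-)^2}{4},\ \kappa^-_{\eta_0^-}-a,\ \beta^-(\hat r^-),\ \beta^-(\eta_0^-)\Big\};$$ $\mathsf C^-=\frac12(C^-)^2((C^-)^2+(C^-+1)^2)$, $\gamma^-=\frac1{C^-+\mathsf C^-}$, and $d_0=\inf\{\|v-w\|_L:v\in F^+_{r_0^+/2},w\in F^-_{r_0^-/2}\}>0$. (H7) $-a<\mathcal E^-_{\max}$ and $\{v\in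 H:\mathcal E(v)<0\}\subset F^-_{r_0^-/2}$. $X$ is the set of $U\in H^1_{loc}(\mathbb R,L)$ for which there is $T\ge1$ with $\mathrm{dist}_L(U(t),F^+)\le r_0^+/2$ for all $t\ge T$ and $\mathrm{dist}_L(U(t),F^-)\le r_0^-/2$ for all $t\le-T$. Existence theorem (the main abstract result of the same work). Under (H1)-(H7) there exist $c^\star>0$ and $\mathbf U\in\mathcal A(\mathbb R)\cap X$ such that $\mathbf U''-D_L\mathcal E(\mathbf U)=-c^\star\mathbf U'$ in $\mathbb R$; $\mathbf U(t)\in F^-_{r_0^-/2}$ for all $t$ close enough to $-\infty$ and $\mathbf U(t)\in F^+_{r_0^+/2}$ for all $t$ large enough; $\mathbf U$ is a global minimizer of $\mathbf E_{c^\star}$ in $X$, with $\mathbf E_{c^\star}(\mathbf U)=0$; and $\mathbf U(t)=\mathfrak P(\mathbf U(t))$ for all $t\in\mathbb R$. The speed $c^\star$ is unique in the sense that if $\overline c>0$, $\inf_{X}\mathbf E_{\overline c}=0$ and some $\overline{\mathbf U}\in\mathcal A(\mathbb R)\cap X$ with $\mathbf E_{\overline c}(\overline{\mathbf U})<+\infty$ solves $\overline{\mathbf U}''-D_L\mathcal E(\overline{\mathbf U})=-\overline c\,\overline{\mathbf U}'$ in $\mathbb R$, then $\overline c=c^\star$. Moreover, there are $M^+>0$ and $\mathbf v^+(\mathbf U)\in F^+$ with $\|\mathbf U(t)-\mathbf v^+(\mathbf U)\|_L\le M^+e^{-c^\star t}$ for all $t\in\mathbb R$. The pair $(c^\star,\mathbf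 U)$ produced by this theorem is ''the solution given by the existence theorem''. *)

(* Defs.v *)
From HB Require Import structures.
From mathcomp Require Import all_boot all_order all_algebra.
From mathcomp Require Import all_classical all_reals all_analysis.
From mathcomp Require Import measurable_realfun.

Set Implicit Arguments.
Unset Strict Implicit.
Unset Printing Implicit Defensive.

Import Order.TTheory GRing.Theory Num.Theory.
Import numFieldNormedType.Exports.

Local Open Scope classical_set_scope.
Local Open Scope ring_scope.

(* `C^k` maps on a subset `A` of a normed space: the derivatives exist in the
   interior of `A` and extend continuously to `A`; for `A` open this is the
   usual notion. *)
Section smooth.
Context {R : realType} {V W : normedModType R}.

(* Continuity on `A` for the operator norm. *)
Definition op_continuous_on (A : set V) (f' : V -> V -> W) : Prop :=
  forall x, A x -> forall e : R, 0 < e ->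
    \forall y \near within A (nbhs x),
      forall h : V, `|f' y h - f' x h| <= e * `|h|.

Definition op2_continuous_on (A : set V) (f'' : V -> V -> V -> W) : Prop :=
  forall x, A x -> forall e : R, 0 < e ->
    \forall y \near within A (nbhs x),
      forall h k : V, `|f'' y h k - f'' x h k| <= e * `|h| * `|k|.

Definition bounded_bilinear (b : V -> V -> W) : Prop :=
  [/\ forall h, linear (b h), forall k, linear (b ^~ k) &
      exists M : R, forall h k, `|b h k| <= M * `|h| * `|k|].

Definition C1_on_with (A : set V) (f : V -> W) (f' : V -> V -> W) : Prop :=
  [/\ {within A, continuous f},
      forall x, A° x -> differentiable f x /\ ('d f x : V -> W) = f' x &
      op_continuous_on A f'].

Definition C1_on (A : set V) (f : V -> W) : Prop :=
  exists f', C1_on_with A f f'.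

Definition C2_on (A : set V) (f : V -> W) : Prop :=
  exists f' f'',
  [/\ C1_on_with A f f',
      forall x, A° x -> bounded_bilinear (f'' x) /\
        forall e : R, 0 < e -> \forall y \near x, forall h,
          `|f' y h - f' x h - f'' x (y - x) h| <= e * `|y - x| * `|h| &
      op2_continuous_on A f''].

End smooth.

Section curves.
Context {R : realType}.
Local Notation mu := (@lebesgue_measure R).

(* `C^1` curves whose support is a compact subset of `O`. *)
Definition C1c {V : normedModType R} (O : set R) (phi : R -> V) : Prop :=
  [/\ forall t, derivable phi t 1, continuous (derive1 phi),
      compact (closure [set t | phi t != 0]) &
      closure [set t | phi t != 0] `<=` O].

Definition C1_curve {V : normedModType R} (O : set R) (u : R -> V) : Prop :=
  (forall t, O t -> derivable u t 1) /\ {in O, continuous (derive1 u)}.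

Definition C2_curve {V : normedModType R} (O : set R) (u : R -> V) : Prop :=
  C1_curve O u /\ C1_curve O (derive1 u).

Definition simple_curve {V : normedModType R} (s : R -> V) : Prop :=
  finite_set (range s) /\ forall y, measurable (s @^-1` [set y]).

(* Bochner measurability, with convergence everywhere on `I` and not only almost
   everywhere: `measurable` refers to the Borel sets, which are not complete for
   the Lebesgue measure, and every class has such a representative. *)
Definition strongly_measurable {V : normedModType R} (I : set R)
    (g : R -> V) : Prop :=
  exists s : nat -> R -> V, (forall n, simple_curve (s n)) /\
    forall t, I t -> s n t @[n --> \oo] --> g t.

Definition L2loc {V : normedModType R} (I : set R) (g : R -> V) : Prop :=
  strongly_measurable I g /\
  forall K, compact K -> K `<=` I ->
    (\int[mu]_(t in K) ((`|g t| ^+ 2)%:E) < +oo)%E.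

(* The `V`-valued identity  int_I phi' u = - int_I phi g  is tested against the
   vectors `w` of `V`, whose inner product is `ip`. *)
Definition weak_derivative {V : normedModType R} (ip : V -> V -> R)
    (I : set R) (u g : R -> V) : Prop :=
  forall phi : R -> R^o, C1c I° phi -> forall w : V,
    (\int[mu]_(t in I) ((derive1 phi t * ip (u t) w)%:E) =
     - \int[mu]_(t in I) ((phi t * ip (g t) w)%:E))%E.

(* A class in `H^1_loc(I, V)` is represented by its continuous
   representative. *)
Definition H1loc {V : normedModType R} (ip : V -> V -> R) (I : set R)
    (u : R -> V) : Prop :=
  [/\ {within I, continuous u}, L2loc I u &
      exists g, L2loc I g /\ weak_derivative ip I u g].

(* A weak derivative of `u` on `I`; unique almost everywhere on `I` when `u` is
   in `H^1_loc(I, V)`. *)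
Definition wderiv {V : normedModType R} (ip : V -> V -> R) (I : set R)
    (u : R -> V) : R -> V :=
  xget (fun=> 0) [set g | L2loc I g /\ weak_derivative ip I u g].

End curves.

Inductive sign := minus | plus.

Section dist.
Context {R : realType} {V : normedModType R}.

(* Equal to `+oo` when `F` is empty. *)
Definition dist (v : V) (F : set V) : \bar R :=
  ereal_inf [set (`|v - f|)%:E | f in F].

Definition tube (F : set V) (r : R) : set V :=
  [set v | (dist v F <= r%:E)%E].

End dist.

(* The inclusions of `Ht` in `H` and of `H` in `L` are the linear
   injections `iotat` and `iota`. *)
Record setting (R : realType) := Setting {
  spL : completeNormedModType R;
  ipL : {dot spL for (idfun : R -> R)};
  ipLE : forall v : spL, ipL v v = `|v| ^+ 2;
  spH : completeNormedModType R;
  ipH : {dot spH for (idfun : R -> R)};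
  ipHE : forall v : spH, ipH v v = `|v| ^+ 2;
  iota : {linear spH -> spL};
  iota_inj : injective iota;
  spHt : normedModType R;
  ipHt : {dot spHt for (idfun : R -> R)};
  ipHtE : forall v : spHt, ipHt v v = `|v| ^+ 2;
  iotat : {linear spHt -> spH};
  iotat_inj : injective iotat;
  calE : spL -> \bar R;
  calE_gtNy : forall v, (-oo < calE v)%E;
  calF : sign -> set spL;
  alevel : R;
  rad0 : sign -> R;
  Ccst : sign -> R;
  projL : sign -> spL -> spL;  (* only meaningful on `FL s (rad0 s)` *)
  gradL : spHt -> spL;
  projH : sign -> spH -> spH;  (* only meaningful on `FH s (rad0 s)` *)
  beta : sign -> R -> R;
  Pfrak : spL -> spL }.

Arguments spL {R} S : rename.
Arguments ipL {R} S : rename.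
Arguments spH {R} S : rename.
Arguments ipH {R} S : rename.
Arguments iota {R} S : rename.
Arguments spHt {R} S : rename.
Arguments ipHt {R} S : rename.
Arguments iotat {R} S : rename.
Arguments calE {R} S : rename.
Arguments calF {R} S : rename.
Arguments alevel {R} S : rename.
Arguments rad0 {R} S : rename.
Arguments Ccst {R} S : rename.
Arguments projL {R} S : rename.
Arguments gradL {R} S : rename.
Arguments projH {R} S : rename.
Arguments beta {R} S : rename.
Arguments Pfrak {R} S : rename.

Section hypotheses.
Context {R : realType} (S : setting R).
Local Notation L := (spL S).
Local Notation H := (spH S).
Local Notation Ht := (spHt S).
Local Notation E := (calE S).
Local Notation iota := (iota S).
Local Notation iotat := (iotat S).
Local Notation F := (calF S).
Local Notation a := (alevel S).
Local Notation r0 := (rad0 S).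
Local Notation C := (Ccst S).
Local Notation P := (projL S).
Local Notation PH := (projH S).
Local Notation DLE := (gradL S).
Local Notation beta := (beta S).
Local Notation Pfrak := (Pfrak S).
Local Notation ip := (ipL S).
Local Notation mu := (@lebesgue_measure R).

(* `a^-` and `a^+` *)
Definition level (s : sign) : R := if s is minus then a else 0.

Definition FL (s : sign) (r : R) : set L := tube (F s) r.

Definition FH (s : sign) (r : R) : set H := tube (iota @^-1` F s) r.

Definition weakly_converges (u : nat -> L) (v : L) : Prop :=
  forall l : {linear L -> R^o}, continuous l -> l (u n) @[n --> \oo] --> l v.

Definition weakly_lsc : Prop :=
  forall (u : nat -> L) (v : L), weakly_converges u v ->
    (E v <= limn_einf (E \o u))%E.

Definition hypH1 : Prop :=
  [/\ weakly_lsc,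
      forall s, closed (F s),
      a < 0 /\ (forall v f, F minus f -> E f = a%:E /\ (a%:E <= E v)%E),
      forall f, F plus f -> E f = 0%E /\ \forall v \near f, (E f <= E v)%E &
   [/\ forall s, 0 < r0 s,
       FL plus (r0 plus) `&` FL minus (r0 minus) = set0,
       forall s, 1 < C s /\ (forall v, FL s (r0 s) v ->
         ((C s)^-1%:E * dist v (F s) ^+ 2 <= E v - (level s)%:E)%E),
       forall s v, FL s (r0 s) v ->
         [/\ F s (P s v), (`|v - P s v|)%:E = dist v (F s) &
             forall p, F s p -> (`|v - p|)%:E = dist v (F s) -> p = P s v] &
       forall s, C2_on (FL s (r0 s)) (P s)]].

Definition EH (h : H) : R^o := fine (E (iota h)).

Definition hypH2 : Prop :=
  [/\ range iota = [set v | (E v < +oo)%E],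
      forall h : H, `|iota h| <= `|h|,
      C1_on setT EH,
      forall x : Ht, `|iotat x| <= `|x| &
      continuous DLE /\
      forall (x : Ht) (w : H),
        ip (DLE x) (iota w) = ('d EH (iotat x) : H -> R^o) w].

Definition hypH3 : Prop :=
  forall s (B : set L), B `<=` F s -> bounded_set B ->
    precompact (iota @^-1` B).

Definition hypH4 : Prop :=
  forall s, bounded_set (F s) \/
    forall v f, FL s (r0 s) v -> F s f ->
      exists Phat : L -> L,
      [/\ P s (Phat v) = f, dist (Phat v) (F s) = dist v (F s),
          E (Phat v) = E v, forall w, differentiable Phat w &
          forall w1 w2, `|('d Phat w1 : L -> L) w2| = `|w2|].

Definition hypH5 : Prop :=
  forall s,
  [/\ forall v, FH s (r0 s) v ->
        [/\ F s (iota (PH s v)),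
            (`|v - PH s v|)%:E = dist v (iota @^-1` F s) &
            forall p, F s (iota p) ->
              (`|v - p|)%:E = dist v (iota @^-1` F s) -> p = PH s v],
      C1_on (FH s (r0 s)) (PH s),
      forall v, FH s (r0 s) v -> forall p : H, iota p = P s (iota v) ->
        `|p - PH s v| <= C s * `|v - PH s v|,
      forall v, FH s (r0 s) v ->
        (((C s) ^- 2 * `|v - PH s v| ^+ 2)%:E <= E (iota v) - (level s)%:E /\
         E (iota v) - (level s)%:E <= ((C s) ^+ 2 * `|v - PH s v| ^+ 2)%:E)%E &
      forall r, 0 < r <= r0 s -> 0 < beta s r /\
        forall v, FL s (r0 s) v -> (E v <= (level s + beta s r)%:E)%E ->
          exists2 h : H, FH s r h & iota h = v].

Definition H1locL (I : set R) (U : R -> L) : Prop := H1loc ip I U.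

Definition density (c : R) (I : set R) (U : R -> L) (t : R) : \bar R :=
  (((2^-1 * `|wderiv ip I U t| ^+ 2)%:E + E (U t)) * (expR (c * t))%:E)%E.

Definition energy (c : R) (I : set R) (U : R -> L) : \bar R :=
  (\int[mu]_(t in I) density c I U t)%E.

(* The integral makes sense in `[-oo, +oo]`. *)
Definition energy_well_defined (c : R) (I : set R) (U : R -> L) : Prop :=
  measurable_fun I (density c I U) /\
  ((\int[mu]_(t in I) ((density c I U)^\+ t) < +oo)%E \/
   (\int[mu]_(t in I) ((density c I U)^\- t) < +oo)%E).

Definition local_minimizer (c : R) (I : set R) (U : R -> L) : Prop :=
  [/\ energy_well_defined c I U, energy c I U \is a fin_num &
      exists2 k : R, 0 < k & forall phi : R -> H, C1c I° phi ->
        (forall t, I t -> `|phi t| < k) ->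
        energy_well_defined c I (fun t => U t + iota (phi t)) /\
        (energy c I U <= energy c I (fun t => U t + iota (phi t))%R)%E].

Definition regular (O : set R) (U : R -> L) : Prop :=
  [/\ C2_curve O U,
      exists2 Uh : R -> H, (forall t, O t -> iota (Uh t) = U t) &
        C1_curve O Uh &
      exists2 Ut : R -> Ht, (forall t, O t -> iota (iotat (Ut t)) = U t) &
        {in O, continuous Ut}].

(* `x` is `U t` seen as an element of `Ht`. *)
Definition solves (c : R) (O : set R) (U : R -> L) : Prop :=
  forall t, O t -> exists2 x : Ht, iota (iotat x) = U t &
    derive1n 2 U t - DLE x = - (c *: derive1 U t).

Definition hypH6 : Prop :=
  [/\ forall v, (E (Pfrak v) <= E v)%E /\ (E (Pfrak v) = E v <-> Pfrak v = v),
      forall v1 v2, `|Pfrak v1 - Pfrak v2| <= `|v1 - v2|,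
      forall s f, F s f -> Pfrak f = f &
      forall (I : set R) (c : R) (W : R -> L),
        open I -> is_interval I -> I !=set0 -> 0 < c ->
        H1locL I W -> local_minimizer c I W ->
        (forall t, I t -> W t = Pfrak (W t)) ->
        regular I W /\ solves c I W].

Definition kappa_minus (r : R) : \bar R :=
  ereal_inf [set E v | v in
    [set v | (r%:E <= dist v (F minus) <= (r0 minus)%:E)%E]].

(* The minimum is a real number even when `kappa_minus` is `+oo`. *)
Definition eta0_minus : R :=
  fine (mine
    (sqrte ((expR (-1) * (r0 minus / 4))%:E *
            sqrte (2%:E * (kappa_minus (r0 minus / 4) - a%:E))))
    (r0 minus / 4)%:E)%E.

Definition rhat_minus : R := r0 minus / (C minus + 1).

Definition Emax_minus : \bar R :=
  (((C minus ^+ 2 * (C minus + 1))^-1)%R%:E *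
   mine (mine (eta0_minus ^+ 2 / 4)%R%:E (kappa_minus eta0_minus - a%:E))
        (mine (beta minus rhat_minus)%:E (beta minus eta0_minus)%:E))%E.

Definition sfC_minus : R :=
  2^-1 * C minus ^+ 2 * (C minus ^+ 2 + (C minus + 1) ^+ 2).

Definition gamma_minus : R := (C minus + sfC_minus)^-1.

Definition d0 : R :=
  inf [set `|vw.1 - vw.2| | vw in
    FL plus (r0 plus / 2) `*` FL minus (r0 minus / 2)].

Definition hypH7 : Prop :=
  ((- a)%:E < Emax_minus)%E /\
  forall h : H, (E (iota h) < 0)%E -> FL minus (r0 minus / 2) (iota h).

Definition admissible : set (R -> L) :=
  [set U | H1locL setT U /\ exists2 T : R, 1 <= T &
    (forall t, T <= t -> FL plus (r0 plus / 2) (U t)) /\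
    (forall t, t <= - T -> FL minus (r0 minus / 2) (U t))].

(* All the properties of the pair `(c, U)` given by the existence theorem for
   heteroclinic travelling waves, including the uniqueness of the speed. *)
Definition existence_solution (c : R) (U : R -> L) : Prop :=
  [/\ 0 < c, regular setT U /\ admissible U, solves c setT U,
      (\forall t \near -oo, FL minus (r0 minus / 2) (U t)) /\
      (\forall t \near +oo, FL plus (r0 plus / 2) (U t)) &
  [/\ (forall V, admissible V -> (energy c setT U <= energy c setT V)%E) /\
        energy c setT U = 0%E,
      forall t, U t = Pfrak (U t),
      forall (c' : R) (V : R -> L), 0 < c' ->
        ereal_inf [set energy c' setT W | W in admissible] = 0%E ->
        regular setT V -> admissible V -> (energy c' setT V < +oo)%E ->
        solves c' setT V -> c' = c &
      exists M : R, exists v : L, [/\ 0 < M, F plus v &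
        forall t, `|U t - v| <= M * expR (- (c * t))]]].

End hypotheses.

(* Main.v *)
(* Write e(t) = E(U(t)) and W(t) = e^{ct} w(t), where
   w = (e - |U'|^2 / 2 - a) / c. The equation gives w' = |U'|^2 and
   W' = (|U'|^2 / 2 + e - a) e^{ct} >= 0. Since the energy of U is 0 and e >= 0
   after the last time t1 at which U lies in the tube around F^-, the integral
   of e^{ct} |U'|^2 / 2 over [t1, oo[ is at most -a e^{c t1} / c. The
   Cauchy-Schwarz inequality then yields (c d0)^2 <= -2a, hence c < gamma.
   The same budget bounds W from below, which forces W(-oo) = 0 and
   0 <= c w <= -a.

   When e(t) <= a + beta, replacing U on ]-oo, t] by the exponential profile
   s |-> p + e^{s - t} (U(t) - p), with p the H-projection of U(t) on F^-, and
   using the minimality of U gives gamma w <= e - a = c w + w' / 2, that is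
   w' >= 2 (gamma - c) w. When e(t) > a + beta, |U'|^2 is bounded below, which
   is better still because w tends to 0. So w decays like
   e^{2 (gamma - c) t} at -oo, and since w' = |U'|^2 the oscillation of U over
   ]-oo, t] is O(e^{(gamma - c) t}). *)
Require Import Defs.
From mathcomp Require Import all_boot all_order all_algebra.
From mathcomp Require Import all_classical all_reals all_analysis.
From mathcomp Require Import measurable_realfun ring lra.
Import Order.TTheory GRing.Theory Num.Theory.
Import numFieldNormedType.Exports.
Local Open Scope classical_set_scope.
Local Open Scope ring_scope.
Set Implicit Arguments.
Unset Strict Implicit.
Unset Printing Implicit Defensive.

(** * Inner products *)

(** Two features of the setting shape the proof. The energy is defined through [wderiv], a weak
    derivative picked by [xget], whereas minimality is exploited on an explicit competitor.
    Evaluating the latter requires that a piecewise C^1 curve have its pointwise derivative as a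
    weak derivative, and that weak derivatives be unique almost everywhere, in a space that is not
    assumed separable. Moreover vector-valued integrals are avoided: each Cauchy-Schwarz estimate
    becomes the monotonicity of a scalar function whose derivative is nonnegative by Young's
    inequality. The competitor uses the H-projection because (H5) bounds E - a from above by the
    squared H-distance. It costs at most K (e(t) - a) e^{ct} with K = (1/2 + C^2) C^2 / 2: the inner
    1/2 is kinetic, the first C^2 is the upper bound in (H5), the second the lower bound, and the
    outer 1/2 bounds 1 / (2 + c). Then gamma K <= 1 by the definition of gamma. Finally (H7) yields
    a + beta > 0, so that e > a + beta together with c w <= -a gives |U'|^2 / 2 = e - a - c w > a +
    beta > 0. *)

Section inner_product.
Context {R : realType} {V : normedModType R}.
Variable ip : {dot V for (idfun : R -> R)}.
Hypothesis ipE : forall v, ip v v = `|v| ^+ 2.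

Lemma dotC x y : ip x y = ip y x.
Proof. by have := @hermitian_subproof _ _ _ _ ip x y; rewrite expr0 mul1r. Qed.

Lemma dotDl x y z : ip (x + y) z = ip x z + ip y z.
Proof. by rewrite linearDl. Qed.

Lemma dotBl x y z : ip (x - y) z = ip x z - ip y z.
Proof. by rewrite linearBl. Qed.

Lemma dotZl k x z : ip (k *: x) z = k * ip x z.
Proof. by rewrite linearZl. Qed.

Lemma dotDr x y z : ip z (x + y) = ip z x + ip z y.
Proof. by rewrite !(dotC z) dotDl. Qed.

Lemma dotBr x y z : ip z (x - y) = ip z x - ip z y.
Proof. by rewrite !(dotC z) dotBl. Qed.

Lemma dotZr k x z : ip z (k *: x) = k * ip z x.
Proof. by rewrite !(dotC z) dotZl. Qed.

(** Expand |x - k y|^2 >= 0. The scale [k] stays free because it is chosen pointwise in time in the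
    two Cauchy-Schwarz arguments below. *)
Lemma dot_le_young (k : R) x y : 2 * k * ip x y <= `|x| ^+ 2 + k ^+ 2 * `|y| ^+ 2.
Proof.
have : 0 <= ip (x - k *: y) (x - k *: y) by rewrite ipE sqr_ge0.
rewrite dotBl !dotBr !dotZl !dotZr !ipE (dotC y x).
set a := ip x y. nra.
Qed.

(** [{dot V for idfun}] is a purely algebraic structure; polarisation ties it to the norm, hence to
    the topology. *)
Lemma dot_polar x y : ip x y = 4^-1 * (`|x + y| ^+ 2 - `|x - y| ^+ 2).
Proof.
rewrite -!ipE dotBl !dotDl !dotBr !dotDr (dotC y x). by field.
Qed.

Lemma cvg_dot {T : Type} (F : set_system T) {FF : Filter F} (f g : T -> V) a b :
  f @ F --> a -> g @ F --> b -> ip (f t) (g t) @[t --> F] --> ip a b.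
Proof.
move=> fa gb; rewrite dot_polar.
under eq_fun do rewrite dot_polar.
apply: cvgM; first exact: cvg_cst.
apply: cvgB.
  rewrite expr2; apply: cvgM; apply: cvg_norm.
  - exact: cvgD.
  - exact: cvgD.
rewrite expr2; apply: cvgM; apply: cvg_norm; exact: cvgB.
Qed.

(** The difference quotient splits into <(u(t+h) - u(t))/h, v(t+h)> + <u(t), (v(t+h) - v(t))/h>; the
    first term also needs v to be continuous at t. *)
Lemma is_derive_dot (u v : R -> V) (t : R) du dv :
  is_derive t 1 u du -> is_derive t 1 v dv ->
  is_derive t 1 (fun s => ip (u s) (v s)) (ip du (v t) + ip (u t) dv).
Proof.
move=> [/cvg_ex[lu /= hu] du_] [/cvg_ex[lv /= hv] dv_].
have {du_} e1 : lu = du by rewrite -du_; apply/esym/cvg_lim.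
have {dv_} e2 : lv = dv by rewrite -dv_; apply/esym/cvg_lim.
subst lu lv.
have cv : v (h *: 1 + t) @[h --> 0^'] --> v t.
  have dv1 : derivable v t 1 by apply/cvg_ex; exists dv.
  have /derivable1_diffP/differentiable_continuous cvt := dv1.
  apply: cvg_comp; last exact: cvt.
  have ct : h *: (1:R) + t @[h --> (0:R)] --> (0:R) *: (1:R) + t.
    by apply: cvgD; [apply: cvgZr_tmp; exact: cvg_id|exact: cvg_cst].
  by rewrite scale0r add0r in ct; exact: cvg_within_filter ct.
have key : h^-1 *: ((ip (u (h *: 1 + t)) (v (h *: 1 + t)) : R^o) - ip (u t) (v t))
   @[h --> 0^'] --> (ip du (v t) + ip (u t) dv : R^o).
  have hc : (fun=> u t) @ (0:R)^' --> u t by exact: cvg_cst.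
  have h1 := @cvg_dot _ _ (dnbhs_filter (0:R)) _ _ _ _ hu cv.
  have h2 := @cvg_dot _ _ (dnbhs_filter (0:R)) _ _ _ _ hc hv.
  apply: cvg_trans; last exact: (@cvgD R R^o _ _ _ _ _ _ _ h1 h2).
  apply: near_eq_cvg; near=> h => /=.
  rewrite [LHS]/(_ + _) dotZl dotZr dotBl dotBr.
  set x := ip (u _) (v _); set y := ip (u t) (v (_ + _)); set z := ip _ _.
  change ((h^-1 * (x - y) + h^-1 * (y - z) : R) = h^-1 * (x - z)).
  by ring.
split; first by apply/cvg_ex; eexists; exact: key.
exact/cvg_lim.
Unshelve. all: by end_near.
Qed.

End inner_product.

(** * Differential inequalities along the profile *)

Section monotonicity.
Context {R : realType}.
Implicit Types f g : R -> R.

Lemma is_derive_continuous (V : normedModType R) (f : R -> V) t df :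
  is_derive t (1 : R) f df -> {for t, continuous f}.
Proof. by move=> [+ _] => /derivable1_diffP/differentiable_continuous. Qed.

Lemma is_derive_ge0_le f g (a b : R) : a <= b ->
  (forall t, a <= t <= b -> is_derive t (1 : R) f (g t)) ->
  (forall t, a < t < b -> 0 <= g t) -> f a <= f b.
Proof.
rewrite le_eqVlt => /predU1P[->//|ab] df g_0.
have [||x xab fE] := @MVT R f g a b ab.
- by move=> x; rewrite in_itv/= => /andP[ax xb]; apply: df; rewrite !ltW.
- apply: continuous_in_subspaceT => x; rewrite inE/= in_itv/= => xab.
  exact: is_derive_continuous (df _ xab).
- rewrite -subr_ge0 fE mulr_ge0 ?g_0 ?subr_ge0 ?ltW//.
Qed.

Lemma derive_small_near_Ny f g (T : R) (m : R) (eps : R) :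
  (forall t, t <= T -> is_derive t (1 : R) f (g t)) ->
  (forall t, t <= T -> m <= f t) -> 0 < eps ->
  exists2 t, t <= T & g t < eps.
Proof.
move=> df fm e0; apply: contrapT => H.
have g_e t : t <= T -> eps <= g t.
  by move=> tT; rewrite leNgt; apply/negP => h; apply: H; exists t.
(* So far to the left that a slope of at least [eps] would force f s <= m - 1. *)
pose s := T - (f T - m + 1) / eps.
have fmT := fm _ (lexx T).
have d0 : 0 <= (f T - m + 1) / eps by rewrite divr_ge0 ?ltW//; lra.
have sT : s <= T by rewrite /s; lra.
have : f s - eps * s <= f T - eps * T.
  apply: (@is_derive_ge0_le (fun t => f t - eps * t) (fun t => g t - eps)) => // t /andP[st tT].
    have ? := df t tT.
    apply: is_derive_eq; rewrite /GRing.scale/=. by ring.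
  by rewrite subr_ge0 g_e// ltW.
have := fm _ sT.
have -> : eps * s = eps * T - (f T - m + 1) by rewrite /s mulrBr mulrCA divff ?gt_eqF// mulr1.
lra.
Qed.

Lemma is_derive_expRM (c t : R) :
  is_derive t (1 : R) (fun s => expR (c * s)) (c * expR (c * t)).
Proof.
have dc : is_derive t (1 : R) (fun s => c * s) c.
  by apply: is_derive_eq; rewrite /GRing.scale/= mulr1.
have := @is_derive1_comp R expR (fun s => c * s) t _ _ (is_derive_expR _) dc.
by rewrite mulrC.
Qed.

Lemma expRM_small (c eps T : R) : 0 < c -> 0 < eps ->
  exists2 s, s < T & expR (c * s) <= eps.
Proof.
move=> c0 e0; exists (Num.min (T - 1) (ln eps / c)).
  by rewrite gt_min ltrBlDr ltrDl ltr01.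
rewrite -[leRHS]lnK ?posrE// ler_expR mulrC -ler_pdivlMr//.
by rewrite ge_min lexx orbT.
Qed.

End monotonicity.

(** * The excess of an abstract wave: speed bound, sign and decay at -oo *)

Section wave.
Context {R : realType} {V : normedModType R}.
Variable ip : {dot V for (idfun : R -> R)}.
Hypothesis ipE : forall v, ip v v = `|v| ^+ 2.
Variables (U U1 : R -> V) (e : R -> R) (a c : R).
Hypothesis c0 : 0 < c.
Hypothesis dU : forall t, is_derive t (1 : R) U (U1 t).
Hypothesis de : forall t, is_derive t (1 : R)
  (fun s => e s - 2^-1 * `|U1 s| ^+ 2) (c * `|U1 t| ^+ 2).
Hypothesis ea : forall t, a <= e t.

(** The function w of the overview; [wexcess] is W. The hypothesis [de] is the equation tested
    against U'. *)
Definition excess t := (e t - 2^-1 * `|U1 t| ^+ 2 - a) / c.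

Lemma is_derive_excess t : is_derive t (1 : R) excess (`|U1 t| ^+ 2).
Proof.
have ? := de t.
have -> : excess = (fun t => c^-1 * ((e t - 2^-1 * `|U1 t| ^+ 2) - a)).
  by apply/funext => s; rewrite /excess mulrC.
apply: is_derive_eq; rewrite /GRing.scale/= subr0.
by have cN0 := lt0r_neq0 c0; field.
Qed.

Lemma excessE t : e t - a = c * excess t + 2^-1 * `|U1 t| ^+ 2.
Proof. by have cN0 := lt0r_neq0 c0; rewrite /excess; field. Qed.

Lemma excess_le s t : s <= t -> excess s <= excess t.
Proof.
move=> st; apply: (is_derive_ge0_le st (fun t _ => is_derive_excess t)) => x _.
exact: sqr_ge0.
Qed.

Definition wexcess t := excess t * expR (c * t).

(** This makes [wexcess] an antiderivative of the energy density minus a e^{ct}, so that energy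
    inequalities become inequalities between its values. *)
Lemma is_derive_wexcess t : is_derive t (1 : R) wexcess
  ((2^-1 * `|U1 t| ^+ 2 + e t - a) * expR (c * t)).
Proof.
have ? := is_derive_excess t.
have ? := is_derive_expRM c t.
apply: is_derive_eq; rewrite /GRing.scale/=.
have := excessE t. set x := _ ^+ 2. set y := expR _.
move=> h; have -> : e t = c * excess t + 2^-1 * x + a by lra.
by have cN0 := lt0r_neq0 c0; field.
Qed.

Lemma wexcess_le s t : s <= t -> wexcess s <= wexcess t.
Proof.
move=> st; apply: (is_derive_ge0_le st (fun t _ => is_derive_wexcess t)) => x _.
rewrite mulr_ge0 ?expR_ge0//. have := ea x. have := sqr_ge0 `|U1 x|. lra.
Qed.

Variables t1 : R.
Hypothesis et1 : forall t, t1 < t -> 0 <= e t.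
(** The terms in t and t1 with the correction a/c are the integral of the energy density over
    [t1, t]; the difference wexcess t1 - wexcess s is that of the density minus a e^{cx} over
    [s, t1]; the right-hand side is the integral of - a e^{cx} over ]-oo, t1]. The inequality
    reflects that the total energy is zero. *)
Hypothesis budget : forall s t, s < t1 < t ->
  wexcess t + a / c * expR (c * t) - (wexcess t1 + a / c * expR (c * t1)) +
  (wexcess t1 - wexcess s) <= - a * expR (c * t1) / c.

Lemma speed_bound t2 : t1 < t2 -> c ^+ 2 * `|U t2 - U t1| ^+ 2 <= - 2 * a.
Proof.
move=> t12; set z := U t2 - U t1.
pose k := c * expR (c * t1).
have k0 : 0 < k by rewrite mulr_gt0 ?expR_gt0.
(* [f] is nondecreasing because of Young's inequality
   [k <U', z> <= |U'|^2 e^{cs} / 2 + k^2 |z|^2 e^{-cs} / 2]; the value of [k] is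
   optimal in the limit t2 --> +oo. *)
pose f s := (wexcess s + a / c * expR (c * s)) - k * ip (U s) z
   - k ^+ 2 / 2 * `|z| ^+ 2 * (expR (- c * s) / c).
have : f t1 <= f t2.
  apply: (@is_derive_ge0_le _ f (fun s => 
    ((2^-1 * `|U1 s| ^+ 2 + e s - a) * expR (c * s)) + a * expR (c * s)
     - k * ip (U1 s) z + k ^+ 2 / 2 * `|z| ^+ 2 * expR (- c * s)) _ _ (ltW t12)).
  - move=> s _.
    have ? := is_derive_wexcess s.
    have ? := is_derive_expRM c s.
    have ? := is_derive_expRM (- c) s.
    have := is_derive_dot ipE (dU s) (is_derive_cst z s 1).
    rewrite (_ : ip (U s) 0 = 0) ?addr0 => [?|]; last by rewrite raddf0.
    apply: is_derive_eq; rewrite /GRing.scale/=.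
    by have cN0 := lt0r_neq0 c0; field.
  - move=> s /andP[ts _].
    have := dot_le_young ipE (k * expR (- c * s)) (U1 s) z.
    have e0 := et1 ts.
    have := expR_gt0 (c * s).
    have : expR (- c * s) * expR (c * s) = 1 by rewrite mulNr -expRD addNr expR0.
    set x := expR (- c * s); set y := expR (c * s); set p := ip _ _.
    move=> xy y0 young.
    (* The relation x * y = 1 is invisible to [field], hence the correction term with factor 1 - x *
       y. *)
    have -> : (2^-1 * `|U1 s| ^+ 2 + e s - a) * y + a * y - k * p
       + k ^+ 2 / 2 * `|z| ^+ 2 * x =
      y * (2^-1 * (`|U1 s| ^+ 2 + (k * x) ^+ 2 * `|z| ^+ 2 - 2 * (k * x) * p) + e s)
      + (1 - x * y) * (k ^+ 2 / 2 * `|z| ^+ 2 * x - k * p) by field.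
    rewrite xy subrr mul0r addr0 mulr_ge0 ?(ltW y0)//.
    by rewrite addr_ge0// mulr_ge0// subr_ge0.
(* Any time before t1 would do in place of t1 - 1: the contribution of [s, t1] is nonnegative and is
   dropped. *)
have := @budget (t1 - 1) t2; rewrite t12 ltrBlDr ltrDl ltr01 => /(_ isT).
have := @wexcess_le (t1 - 1) t1; rewrite lerBlDr lerDl ler01 => /(_ isT).
have : expR (- c * t1) * expR (c * t1) = 1 by rewrite mulNr -expRD addNr expR0.
have : expR (- c * t2) >= 0 by exact: expR_ge0.
have X0 := expR_gt0 (c * t1).
rewrite /f.
have -> : `|z| ^+ 2 = ip (U t2) z - ip (U t1) z by rewrite -ipE -dotBl.
have : 0 <= ip (U t2) z - ip (U t1) z by rewrite -dotBl ipE sqr_ge0.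
rewrite /k.
move: X0; set X := expR (c * t1); set x := expR (- c * t1).
set y := expR (- c * t2); set p := ip (U t2) z; set q := ip (U t1) z.
set G2 := wexcess t2 + _; set G1 := wexcess t1 + _.
move=> X0 pq y0 xX Wle B ineq.
have G21 : G2 - G1 <= - a * X / c by lra.
have cN0 := lt0r_neq0 c0.
have : c * X * (p - q) <= G2 - G1 + (c * X) ^+ 2 / 2 * (p - q) * (x / c).
  have : 0 <= (c * X) ^+ 2 / 2 * (p - q) * (y / c).
    by rewrite mulr_ge0// ?divr_ge0 ?(ltW c0)// mulr_ge0// divr_ge0// sqr_ge0.
  lra.
have -> : (c * X) ^+ 2 / 2 * (p - q) * (x / c) = (x * X) * (c * X / 2 * (p - q)).
  by field.
rewrite xX mul1r => h.
have {}h : c * X * (p - q) / 2 <= - a * X / c by lra.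
rewrite -(ler_pM2r (divr_gt0 X0 c0)).
have -> : c ^+ 2 * (p - q) * (X / c) = 2 * (c * X * (p - q) / 2) by field.
have -> : - 2 * a * (X / c) = 2 * (- a * X / c) by field.
lra.
Qed.

(** By [budget], W is bounded below on ]-oo, t1[, so W' is arbitrarily small at some time before t.
    At that time c W >= - e^{ct} |U'|^2 / 2 >= - W', and W is nondecreasing. *)
Lemma wexcess_ge0 t : 0 <= wexcess t.
Proof.
apply/ler_addgt0Pr => eps e0.
pose T := Num.min t (t1 - 1).
have Tt : T <= t by rewrite ge_min lexx.
have Tt1 : T < t1.
  by rewrite (@le_lt_trans _ _ (t1 - 1)) ?ge_min ?lexx ?orbT// ltrBlDr ltrDl.
have [||s sT ds] := @derive_small_near_Ny _ wexcess _ T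
  (wexcess (t1 + 1) + a / c * expR (c * (t1 + 1)) -
   (wexcess t1 + a / c * expR (c * t1)) + wexcess t1 + a * expR (c * t1) / c)
  (eps * c) (fun t _ => is_derive_wexcess t).
- move=> s sT; have := @budget s (t1 + 1).
  by rewrite (le_lt_trans sT Tt1) ltrDl ltr01 => /(_ isT); lra.
- by rewrite mulr_gt0.
have := wexcess_le (le_trans sT Tt).
suff : - eps <= wexcess s by lra.
rewrite -(ler_pM2r c0).
have cN0 := lt0r_neq0 c0.
have -> : wexcess s * c = (e s - 2^-1 * `|U1 s| ^+ 2 - a) * expR (c * s).
  by rewrite /wexcess /excess; field.
have : 0 <= (e s - a) * expR (c * s).
  by rewrite mulr_ge0 ?expR_ge0// subr_ge0.
move: ds; set x := expR _; set y := _ ^+ 2. lra.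
Qed.

Lemma excess_ge0 t : 0 <= excess t.
Proof. by have := wexcess_ge0 t; rewrite /wexcess pmulr_lge0// expR_gt0. Qed.

(** Let s tend to -oo in [budget]: w is bounded on ]-oo, t1], so W(s) tends to 0, and the part over
    [t1, t] is nonnegative because e >= 0 there. *)
Lemma excess_ub t : t <= t1 -> c * excess t <= - a.
Proof.
move=> tt1.
suff : wexcess t1 <= - a * expR (c * t1) / c.
  rewrite /wexcess (mulrAC (- a)) (ler_pM2r (expR_gt0 (c * t1))) => h.
  rewrite mulrC -ler_pdivlMr//; exact: le_trans (excess_le tt1) h.
apply/ler_addgt0Pr => eps e0.
(* The + 1 gives a strictly positive bound of w on ]-oo, t1], by which one may divide. *)
have x0 : 0 < excess t1 + 1 by have := excess_ge0 t1; lra.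
have [s st1 sexp] := @expRM_small _ c (eps / (excess t1 + 1)) t1 c0 (divr_gt0 e0 x0).
have Ws : wexcess s <= eps.
  apply: (@le_trans _ _ ((excess t1 + 1) * expR (c * s))).
    rewrite ler_pM2r ?expR_gt0//; have := excess_le (ltW st1); lra.
  by rewrite mulrC -ler_pdivlMr.
have := @budget s (t1 + 1); rewrite st1 ltrDl ltr01 => /(_ isT).
suff : wexcess t1 + a / c * expR (c * t1) <=
   wexcess (t1 + 1) + a / c * expR (c * (t1 + 1)) by lra.
apply: (@is_derive_ge0_le _ (fun s => wexcess s + a / c * expR (c * s))
  (fun s => (2^-1 * `|U1 s| ^+ 2 + e s) * expR (c * s))).
- by rewrite lerDl.
- move=> x _.
  have ? := is_derive_wexcess x.
  have ? := is_derive_expRM c x.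
  apply: is_derive_eq; rewrite /GRing.scale/=.
  by have cN0 := lt0r_neq0 c0; field.
- move=> x /andP[tx _]; rewrite mulr_ge0 ?expR_ge0// addr_ge0 ?et1//.
Qed.

Variables (b g K T0 : R).
Hypothesis (ab : 0 < a + b) (cg : c < g) (gK : g * K <= 1).
(** What minimality against the exponential profile yields, stated without the competitor so that
    the rest is a pure differential inequality. The variables [b], [g] and [K] stand for beta, gamma
    and the cost constant of that profile. *)
Hypothesis comparison : forall t, t <= T0 -> e t <= a + b ->
  forall s, s < t -> wexcess t - wexcess s <= K * (e t - a) * expR (c * t).

(** Let s tend to -oo in [comparison], where W(s) tends to 0, and use g K <= 1. *)
Lemma excess_le_energy t : t <= T0 -> e t <= a + b -> g * excess t <= e t - a.
Proof.
move=> tT0 eb.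
have g0 := lt_trans c0 cg.
suff h : wexcess t <= K * (e t - a) * expR (c * t).
  move: h; rewrite (ler_pM2r (expR_gt0 (c * t))) => h.
  rewrite (@le_trans _ _ (g * (K * (e t - a))))// ?ler_pM2l//.
  by rewrite mulrA ler_piMl// subr_ge0.
apply/ler_addgt0Pr => eps e0.
have x0 : 0 < excess t + 1 by have := excess_ge0 t; lra.
have [s st sexp] := @expRM_small _ c (eps / (excess t + 1)) t c0 (divr_gt0 e0 x0).
have Ws : wexcess s <= eps.
  apply: (@le_trans _ _ ((excess t + 1) * expR (c * s))).
    rewrite ler_pM2r ?expR_gt0//; have := excess_le (ltW st); lra.
  by rewrite mulrC -ler_pdivlMr.
have := comparison tT0 eb st; lra.
Qed.

(** If |U'|^2 <= 2 (a + b), then c w <= -a gives e - a = c w + |U'|^2 / 2 <= b, so the comparison is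
    available at t. *)
Lemma excess_dichotomy t : t <= T0 -> t <= t1 ->
  2 * (g - c) * excess t <= `|U1 t| ^+ 2 \/ 2 * (a + b) < `|U1 t| ^+ 2.
Proof.
move=> tT0 tt1; have := excess_le_energy tT0.
have := excessE t; have := excess_ub tt1.
set x := `|_| ^+ 2 => h1 h2 h3.
have [xb|?] := leP x (2 * (a + b)); [left|by right].
have /h3 : e t <= a + b by lra.
rewrite h2; lra.
Qed.

Lemma small_near_Ny (T eps : R) : 0 < eps ->
  exists t, [/\ t <= T, `|U1 t| ^+ 2 < eps & 2 * (g - c) * excess t < eps].
Proof.
move=> e0.
pose T' := Num.min T (Num.min T0 t1).
have T'T : T' <= T by rewrite ge_min lexx.
have T'T0 : T' <= T0 by rewrite !ge_min lexx !orbT.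
have T't1 : T' <= t1 by rewrite !ge_min lexx !orbT.
(* Capping [eps] at 2 (a + b) excludes the second alternative of the dichotomy. *)
have [||t tT' ht] := @derive_small_near_Ny _ excess _ T' 0
  (Num.min eps (2 * (a + b))) (fun t _ => is_derive_excess t).
- by move=> t _; exact: excess_ge0.
- by rewrite lt_min e0 /= mulr_gt0.
move: ht; rewrite lt_min => /andP[h1 h2]; exists t; split => //.
  exact: le_trans tT' T'T.
have [h|] := excess_dichotomy (le_trans tT' T'T0) (le_trans tT' T't1).
  exact: le_lt_trans h h1.
by move=> /(lt_trans h2); rewrite ltxx.
Qed.

(** Smallness at some times tending to -oo is what places the limit of U in F^-. *)
Lemma energy_small_near_Ny (T eps : R) : 0 < eps ->
  exists2 t, t <= T & e t - a < eps.
Proof.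
move=> e0.
have gc0 : 0 < g - c by rewrite subr_gt0.
(* In e - a = c w + |U'|^2 / 2, the term c w is c / (g - c) times half of 2 (g - c) w; [k] adds up
   the weights of the two small quantities. *)
pose k := 1 + c / (g - c).
have k0 : 0 < k by rewrite addr_gt0// divr_gt0.
have [t [tT h1 h2]] := small_near_Ny T (divr_gt0 e0 k0).
exists t => //; rewrite excessE.
have gcN0 := lt0r_neq0 gc0.
have : (c / (g - c)) * (2 * (g - c) * excess t) <= (c / (g - c)) * (eps / k).
  by rewrite ler_pM2l ?divr_gt0//; exact: ltW.
have -> : (c / (g - c)) * (2 * (g - c) * excess t) = 2 * (c * excess t) by field.
have : eps = eps / k + (c / (g - c)) * (eps / k).
  by rewrite -{1}[eps / k]mul1r -mulrDl -/k mulrC divfK// lt0r_neq0.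
have : 0 <= c * excess t by rewrite mulr_ge0 ?excess_ge0// ltW.
have : 0 <= `|U1 t| ^+ 2 by exact: sqr_ge0.
lra.
Qed.

Lemma excess_decay : exists2 T, T <= T0 & exists2 M, 0 <= M &
  forall t, t <= T -> excess t <= M * expR (2 * (g - c) * t).
Proof.
have ab0 : 0 < 2 * (a + b) by rewrite mulr_gt0.
have gc0 : 0 < g - c by rewrite subr_gt0.
(* Before this T, monotonicity keeps 2 (g - c) w below 2 (a + b), so both alternatives of the
   dichotomy imply w' >= 2 (g - c) w. *)
have [T [TT _ hT]] := small_near_Ny (Num.min T0 t1) ab0.
have TT0 : T <= T0 by rewrite (le_trans TT)// ge_min lexx.
have Tt1 : T <= t1 by rewrite (le_trans TT)// ge_min lexx orbT.
exists T => //; exists (excess T * expR (- (2 * (g - c)) * T)).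
  by rewrite mulr_ge0 ?expR_ge0// excess_ge0.
move=> t tT.
have inc : excess t * expR (- (2 * (g - c)) * t) <= excess T * expR (- (2 * (g - c)) * T).
  apply: (@is_derive_ge0_le _ (fun t => excess t * expR (- (2 * (g - c)) * t))
    (fun t => (`|U1 t| ^+ 2 - 2 * (g - c) * excess t) * expR (- (2 * (g - c)) * t)) _ _ tT).
  - move=> x _.
    have ? := is_derive_excess x.
    have ? := is_derive_expRM (- (2 * (g - c))) x.
    by apply: is_derive_eq; rewrite /GRing.scale/=; ring.
  - move=> x /andP[_ xT]; rewrite mulr_ge0 ?expR_ge0// subr_ge0.
    have xT' := ltW xT.
    have [//|h] := excess_dichotomy (le_trans xT' TT0) (le_trans xT' Tt1).
    apply: le_trans (ltW h); apply: le_trans (ltW hT).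
    by rewrite ler_pM2l ?excess_le// mulr_gt0.
rewrite -(ler_pM2r (expR_gt0 (- (2 * (g - c)) * t))) -[leRHS]mulrA -expRD.
by rewrite mulNr subrr expR0 mulr1 -mulNr.
Qed.

Lemma profile_cauchy_near_Ny : exists2 T, T <= T0 & exists2 M, 0 < M &
  forall s t, s <= t -> t <= T -> `|U t - U s| <= M * expR ((g - c) * t).
Proof.
have [T TT0 [M M0 decay]] := excess_decay.
have n0 : 0 < g - c by rewrite subr_gt0.
set n := g - c in decay n0 *.
have nN0 := lt0r_neq0 n0.
(* The + 1 keeps the constant positive when M = 0. *)
exists T => //; exists (Num.sqrt (2 * M / n + 1)).
  rewrite sqrtr_gt0 ltr_pwDr// divr_ge0 ?(ltW n0)// mulr_ge0//.
move=> s t st tT; set z := U t - U s.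
have m0 : 0 <= 2 * M / n by rewrite divr_ge0 ?(ltW n0)// mulr_ge0.
rewrite -[leLHS]ger0_norm// -sqrtr_sqr -[expR _]ger0_norm ?expR_ge0// -sqrtr_sqr.
rewrite -sqrtrM ?ler_wsqrtr//; last lra.
(* Cauchy-Schwarz for [<U', z>] with the weight [expR (- n * x)] on |U'|^2,
   which stays integrable at -oo as |U'|^2 is the derivative of [excess]. *)
pose k := expR (n * t) / n.
have k0 : 0 < k by rewrite divr_gt0 ?expR_gt0.
(* Differentiating the weight produces - n w e^{-nx}, which M e^{nx} compensates by the decay of w.
   With this [k], the term |z|^2 e^{nt} / n equals k |z|^2 and is absorbed by the 2 k |z|^2 coming
   from the inner products. *)
pose f x := k ^+ 2 * (excess x * expR (- n * x) + M * expR (n * x)) +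
  `|z| ^+ 2 / n * expR (n * x) - 2 * k * ip (U x) z.
have : f s <= f t.
  apply: (@is_derive_ge0_le _ f (fun x =>
    k ^+ 2 * (`|U1 x| ^+ 2 * expR (- n * x) - n * excess x * expR (- n * x)
     + n * M * expR (n * x)) + `|z| ^+ 2 * expR (n * x) - 2 * k * ip (U1 x) z) _ _ st).
  - move=> x _.
    have ? := is_derive_excess x.
    have ? := is_derive_expRM n x.
    have ? := is_derive_expRM (- n) x.
    have := is_derive_dot ipE (dU x) (is_derive_cst z x 1).
    rewrite (_ : ip (U x) 0 = 0) ?addr0 => [?|]; last by rewrite raddf0.
    by apply: is_derive_eq; rewrite /GRing.scale/=; field.
  - move=> x /andP[_ xt].
    have := dot_le_young ipE (expR (n * x) / k) (U1 x) z.
    have := decay _ (le_trans (ltW xt) tT).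
    have -> : 2 * n * x = n * x + n * x by ring.
    rewrite expRD.
    have := expR_gt0 (n * x); have := expR_gt0 (- n * x).
    have : expR (- n * x) * expR (n * x) = 1 by rewrite mulNr -expRD addNr expR0.
    set X := expR (n * x); set Y := expR (- n * x); set p := ip _ _.
    set E := excess x; set u := `|U1 x| ^+ 2; set q := `|z| ^+ 2.
    move=> YX Y0 X0 EM young.
    have kN0 := lt0r_neq0 k0.
    have -> : k ^+ 2 * (u * Y - n * E * Y + n * M * X) + q * X - 2 * k * p =
      Y * k ^+ 2 * (u + (X / k) ^+ 2 * q - 2 * (X / k) * p)
      + n * k ^+ 2 * Y * (M * (X * X) - E)
      + (1 - Y * X) * (q * X - 2 * k * p + n * k ^+ 2 * M * X) by field.
    rewrite YX subrr mul0r addr0 addr_ge0// mulr_ge0 ?subr_ge0//.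
      by rewrite mulr_ge0 ?sqr_ge0// ltW.
    rewrite mulr_ge0 ?(ltW Y0)// mulr_ge0 ?sqr_ge0//; exact: ltW.
have : 0 <= k ^+ 2 * (excess s * expR (- n * s) + M * expR (n * s)).
  by rewrite mulr_ge0 ?sqr_ge0// addr_ge0// mulr_ge0 ?expR_ge0// excess_ge0.
have : 0 <= `|z| ^+ 2 / n * expR (n * s).
  by rewrite mulr_ge0 ?expR_ge0// divr_ge0 ?sqr_ge0// ltW.
have : k ^+ 2 * (excess t * expR (- n * t)) <= k ^+ 2 * (M * expR (n * t)).
  rewrite ler_wpM2l ?sqr_ge0//.
  rewrite -(ler_pM2r (expR_gt0 (n * t))) -mulrA -expRD mulNr addNr expR0 mulr1.
  rewrite -mulrA -expRD (_ : n * t + n * t = 2 * n * t); last by ring.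
  exact: decay.
have pq : `|z| ^+ 2 = ip (U t) z - ip (U s) z by rewrite -ipE -dotBl.
have z0 : 0 <= `|z| ^+ 2 by exact: sqr_ge0.
rewrite /f [X in _ <= X + _ - _]mulrDr.
set A := k ^+ 2 * (excess t * _); set B := k ^+ 2 * (M * expR (n * t)).
set C := `|z| ^+ 2 / n * expR (n * s); set C' := k ^+ 2 * (_ + _).
set D := `|z| ^+ 2 / n * expR (n * t).
move=> AB C0 C'0 ineq.
have {}ineq : 2 * k * `|z| ^+ 2 <= 2 * B + D by rewrite pq; lra.
have Bk : 2 * B = k * (2 * M / n * expR (n * t) ^+ 2) by rewrite /B /k; field.
have qk : D = k * `|z| ^+ 2 by rewrite /D /k; field.
have : `|z| ^+ 2 <= 2 * M / n * expR (n * t) ^+ 2.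
  rewrite -(ler_pM2l k0); lra.
move=> /le_trans; apply; rewrite ler_wpM2r ?sqr_ge0//; lra.
Qed.

End wave.

(** * Limit at -oo of a curve with exponentially small oscillation *)

Lemma limit_near_Ny (R : realType) (V : completeNormedModType R) (U : R -> V)
    (n T M : R) : 0 < n -> 0 < M ->
  (forall s t, s <= t -> t <= T -> `|U t - U s| <= M * expR (n * t)) ->
  exists v, forall t, t <= T -> `|U t - v| <= M * expR (n * t).
Proof.
move=> n0 M0 UM.
have Ucvg : cvg (U t @[t --> -oo]).
  apply: cauchy_cvg; apply: cauchy_exP => eps e0.
  have [s sT sE] := @expRM_small _ n (eps / (2 * M)) T n0 (divr_gt0 e0 (mulr_gt0 (ltr0Sn _ 1) M0)).
  exists (U s); change (\forall x \near -oo, ball (U s) eps (U x)); near=> x.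
  have xs : x <= s by near: x; apply: nbhs_ninfty_le; rewrite num_real.
  rewrite -ball_normE /ball_/=.
  apply: le_lt_trans (UM _ _ xs (ltW sT)) _.
  apply: (@le_lt_trans _ _ (M * (eps / (2 * M)))).
    by rewrite ler_pM2l.
  have MN0 := lt0r_neq0 M0.
  have -> : M * (eps / (2 * M)) = eps / 2 by field.
  lra.
exists (lim (U t @[t --> -oo])) => t tT.
apply/ler_addgt0Pr => eps e0.
have /cvgrPdist_lt/(_ _ e0) := Ucvg.
move=> [A [Ar hA]].
pose s := Num.min t (A - 1).
have sA : s < A by rewrite gt_min ltrBlDr ltrDl ltr01 orbT.
have st : s <= t by rewrite ge_min lexx.
have -> : U t - lim (U t @[t --> -oo]) = (U t - U s) - (lim (U t @[t --> -oo]) - U s).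
  by rewrite opprB addrA subrK.
apply: le_trans (ler_normB _ _) _; apply: lerD; first exact: UM.
exact/ltW/hA.
Unshelve. all: by end_near.
Qed.

(** * Strong measurability and weak derivatives *)

Section strong_measurability.
Context {R : realType} {V : normedModType R}.
Local Notation mu := (@lebesgue_measure R).
Implicit Types (s u v : R -> V).

Lemma simple_curve_preimage s (A : set V) : simple_curve s ->
  measurable (s @^-1` A).
Proof.
move=> [fs ms].
rewrite (_ : s @^-1` A = \bigcup_(y in range s `&` A) s @^-1` [set y]).
  apply: fin_bigcup_measurable => //; exact: finite_setIl.
apply/seteqP; split => [t At|t [y [_ Ay] /= ty]]; last by rewrite /preimage/= ty.
by exists (s t) => //; split => //; exists t.
Qed.

Lemma simple_curve_piecewise (p : R -> bool) s1 s2 : measurable [set t | p t] ->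
  simple_curve s1 -> simple_curve s2 ->
  simple_curve (fun t => if p t then s1 t else s2 t).
Proof.
move=> mp h1 h2; split.
  apply: (@sub_finite_set _ _ (range s1 `|` range s2)).
    by move=> y [t _ <-]; case: ifP => _; [left|right]; exists t.
  by rewrite finite_setU; split; [exact: h1.1|exact: h2.1].
move=> y; rewrite (_ : _ @^-1` _ = ([set t | p t] `&` s1 @^-1` [set y]) `|`
    (~` [set t | p t] `&` s2 @^-1` [set y])).
  apply: measurableU; apply: measurableI => //; try exact: simple_curve_preimage.
  exact: measurableC.
apply/seteqP; split => t /=.
  by case: ifPn => pt e; [left|right]; split => //; exact/negP.
by case=> -[pt e]; [rewrite pt|rewrite (negbTE (introN idP pt))].
Qed.

Lemma simple_curveB s1 s2 : simple_curve s1 -> simple_curve s2 ->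
  simple_curve (fun t => s1 t - s2 t).
Proof.
move=> h1 h2; split.
  apply: (@sub_finite_set _ _ [set x - y | x in range s1 & y in range s2]).
    by move=> y [t _ <-]; exists (s1 t); [exists t|exists (s2 t) => //; exists t].
  by apply: finite_image2; [exact: h1.1|exact: h2.1].
move=> y; rewrite (_ : _ @^-1` _ = \bigcup_(x in range s1)
    (s1 @^-1` [set x] `&` s2 @^-1` [set x - y])).
  apply: fin_bigcup_measurable; first exact: h1.1.
  by move=> x _; apply: measurableI; exact: simple_curve_preimage.
apply/seteqP; split => t /=.
  by move=> <-; exists (s1 t); [exists t|split => //=; rewrite opprB addrCA subrr addr0].
by move=> [x _ [/= -> ->]]; rewrite opprB addrCA subrr addr0.
Qed.

Lemma strongly_measurable_piecewise (p : R -> bool) u v : measurable [set t | p t] ->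
  strongly_measurable setT u -> strongly_measurable setT v ->
  strongly_measurable setT (fun t => if p t then u t else v t).
Proof.
move=> mp [s [hs su]] [r [hr rv]].
exists (fun n t => if p t then s n t else r n t); split.
  by move=> n; exact: simple_curve_piecewise.
by move=> t _; case: ifP => _; [exact: su|exact: rv].
Qed.

Lemma strongly_measurableB u v :
  strongly_measurable setT u -> strongly_measurable setT v ->
  strongly_measurable setT (fun t => u t - v t).
Proof.
move=> [s [hs su]] [r [hr rv]].
exists (fun n t => s n t - r n t); split.
  by move=> n; exact: simple_curveB.
by move=> t _; apply: cvgB; [exact: su|exact: rv].
Qed.

Lemma strongly_measurable_comp (q : V -> R) u : continuous q ->
  strongly_measurable setT u -> measurable_fun setT (q \o u).
Proof.
move=> cq [s [hs su]].
apply: (@measurable_fun_cvg _ _ _ _ (fun n => q \o s n)).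
  move=> n _ B mB; rewrite setTI comp_preimage; exact: simple_curve_preimage.
move=> t _; apply: continuous_cvg; first exact: cq.
exact: su.
Qed.

(** Sample [u] at the left ends of cells of length 1 / (n + 1) covering [-n, n[. Index 0 is reserved
    for the outside of this window, whence the shift by one in [k] and [q]. *)
Lemma continuous_strongly_measurable u :
  continuous u -> strongly_measurable setT u.
Proof.
move=> cu.
pose k n (t : R) : nat := if - n%:R <= t < n%:R
  then (Num.truncn ((t + n%:R) * n.+1%:R)).+1 else 0%N.
pose q n (j : nat) : V := if j is i.+1 then u (i%:R / n.+1%:R - n%:R) else 0.
exists (fun n t => q n (k n t)); split.
  move=> n; split.
    apply: (@sub_finite_set _ _ (q n @` `I_(2 * n * n.+1).+2)).
      move=> _ [t _ <-]; exists (k n t) => //=.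
      rewrite /k; case: ifPn => // /andP[nt tn].
      have h0 : 0 <= (t + n%:R) * n.+1%:R by rewrite mulr_ge0//; lra.
      have hn : (t + n%:R) * n.+1%:R <= (2 * n * n.+1)%:R.
        rewrite !natrM ler_wpM2r//; lra.
      rewrite ltnS ltnS -(ler_nat R); apply: le_trans hn.
      by rewrite truncn_le.
    exact/finite_image/finite_II.
  move=> y.
  (* Distinct cells may carry the same value of [u], so a level set is a union over indices. *)
  rewrite (_ : _ @^-1` _ = \bigcup_(j in [set j | q n j = y]) (k n @^-1` [set j])).
    apply: bigcup_measurable => j _.
    case: j => [|j].
      rewrite (_ : _ @^-1` _ = ~` `[- n%:R, n%:R[%classic).
        exact: measurableC.
      apply/seteqP; split => t; rewrite /k/= in_itv/=; first by case: ifP => //.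
      by case: ifPn.
    rewrite (_ : _ @^-1` _ = `[- n%:R, n%:R[%classic `&`
      `[j%:R / n.+1%:R - n%:R, j.+1%:R / n.+1%:R - n%:R[%classic).
      exact: measurableI.
    apply/seteqP; split => t; rewrite /k/= !in_itv/=.
      case: ifPn => // /andP[nt tn] [<-]; split => //.
      have h0 : 0 <= (t + n%:R) * n.+1%:R by rewrite mulr_ge0//; lra.
      rewrite lerBlDr ltrBrDr ler_pdivrMr// ltr_pdivlMr//.
      exact: truncn_itv.
    move=> [-> /andP[h1 h2]]; congr S; apply/esym/eqP.
    rewrite eq_sym truncn_eq.
      by rewrite -ler_pdivrMr// -ltr_pdivlMr// -lerBlDr h1 -ltrBrDr h2.
    by rewrite mulr_ge0//; move: h1; rewrite lerBlDr; apply: le_trans; rewrite divr_ge0.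
  apply/seteqP; split => t /=; first by move=> e; exists (k n t).
  by move=> [j /= <- ->].
move=> t _.
pose tn n : R := (k n t).-1%:R / n.+1%:R - n%:R.
have kt : \forall n \near \oo, q n (k n t) = u (tn n) /\ `|t - tn n| <= n.+1%:R^-1.
  near=> n.
  have nt : `|t| < n%:R by near: n; exact: nbhs_infty_gtr.
  have tin : - n%:R <= t < n%:R by move: nt; rewrite ltr_norml => /andP[/ltW -> ->].
  rewrite /tn /k tin /q/=; split => //.
  have h0 : 0 <= (t + n%:R) * n.+1%:R.
    by rewrite mulr_ge0//; case/andP: tin => ? _; lra.
  have /andP[] := truncn_itv h0.
  rewrite -ler_pdivrMr// -ltr_pdivlMr//.
  set j := Num.truncn _; rewrite -[j.+1%:R]natr1 mulrDl mul1r.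
  set x := _ / _; set y := _^-1 => h1 h2.
  by rewrite ler_norml; apply/andP; split; lra.
have tnt : tn n @[n --> \oo] --> t.
  apply/cvgrPdist_le => e e0; near=> n.
  have [_ h] : q n (k n t) = u (tn n) /\ `|t - tn n| <= n.+1%:R^-1 by near: n.
  apply: le_trans h _.
  have : e^-1 < n%:R by near: n; exact: nbhs_infty_gtr.
  move=> en; rewrite invf_ple ?posrE//; apply: le_trans (ltW en) _.
  by rewrite ler_nat.
apply: (@cvg_trans _ (u (tn n) @[n --> \oo])).
  apply: near_eq_cvg; near=> n.
  by have [-> _] : q n (k n t) = u (tn n) /\ `|t - tn n| <= n.+1%:R^-1 by near: n.
by apply: continuous_cvg => //; exact: cu.
Unshelve. all: by end_near.
Qed.

End strong_measurability.

(** * Local square integrability and its consequences *)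

Section L2loc.
Context {R : realType} {V : normedModType R}.
Local Notation mu := (@lebesgue_measure R).
Variable ip : {dot V for (idfun : R -> R)}.
Hypothesis ipE : forall v, ip v v = `|v| ^+ 2.

Lemma cst_compact_integrable (K : set R) (r : R) : compact K ->
  mu.-integrable K (fun=> r%:E).
Proof.
move=> cK; apply: (@continuous_compact_integrable R (cst r)) => //.
by apply: continuous_subspaceT => x; exact: cvg_cst.
Qed.

Lemma continuous_sqr_norm : continuous (fun v : V => `|v| ^+ 2).
Proof. move=> v; exact: (cvgM (cvg_norm cvg_id) (cvg_norm cvg_id)). Qed.

Lemma L2loc_le (g : R -> V) (b : R -> R) : strongly_measurable setT g ->
  continuous b -> (forall t, `|g t| ^+ 2 <= b t) -> L2loc setT g.
Proof.
move=> mg cb gb; split => // K cK _.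
have ib : mu.-integrable K (EFin \o b).
  by apply: continuous_compact_integrable => //; exact: continuous_subspaceT.
have mK := compact_measurable cK.
apply: (@le_lt_trans _ _ (\int[mu]_(t in K) (b t)%:E)%E); last first.
  exact: (integrable_lty _ ib).
apply: ge0_le_integral => //.
- apply/measurable_EFinP/(measurable_funS measurableT) => //.
  apply: (strongly_measurable_comp (q := fun v => `|v| ^+ 2)) mg.
  exact: continuous_sqr_norm.
- by have /measurable_int := ib.
- by move=> t _; rewrite lee_fin.
Qed.

Lemma dot_continuousl (w : V) : continuous (ip^~ w).
Proof. by move=> v; apply: (cvg_dot ipE); [exact: cvg_id|exact: cvg_cst]. Qed.

(** A crude form of Cauchy-Schwarz, from Young's inequality with k = 1 and k = -1; it suffices for
    integrability. *)
Lemma norm_dot_le v w : `|ip v w| <= `|v| ^+ 2 + `|w| ^+ 2.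
Proof.
have := dot_le_young ipE 1 v w; have := dot_le_young ipE (-1) v w.
rewrite expr1n sqrrN expr1n ler_norml.
have := sqr_ge0 `|v|; have := sqr_ge0 `|w|.
by move=> *; apply/andP; split; lra.
Qed.

Lemma L2loc_locally_integrable (g : R -> V) (w : V) : L2loc setT g ->
  locally_integrable setT (fun t => ip (g t) w).
Proof.
move=> [mg Lg]; split; [|exact: openT|].
  exact: (strongly_measurable_comp (q := fun v => ip v w) (@dot_continuousl w) mg).
move=> K KT cK.
have mK := compact_measurable cK.
have mg2 : measurable_fun K (fun t => (`|g t| ^+ 2)%:E).
  apply/measurable_EFinP/(measurable_funS measurableT) => //.
  apply: (strongly_measurable_comp (q := fun v => `|v| ^+ 2)) mg.
  exact: continuous_sqr_norm.
apply: (@le_lt_trans _ _ (\int[mu]_(t in K) ((`|g t| ^+ 2)%:E + (`|w| ^+ 2)%:E))%E).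
  apply: ge0_le_integral => //.
  - apply/measurable_EFinP/measurableT_comp => //.
    apply: (measurable_funS measurableT) => //.
    exact: (strongly_measurable_comp (q := fun v => ip v w) (@dot_continuousl w) mg).
  - exact: emeasurable_funD.
  - by move=> t _; rewrite lee_fin norm_dot_le.
have i2 : mu.-integrable K (fun t => (`|g t| ^+ 2)%:E).
  apply/integrableP; split => //.
  under eq_integral do rewrite gee0_abs ?lee_fin ?sqr_ge0//.
  exact: Lg.
have iw := @cst_compact_integrable K (`|w| ^+ 2) cK.
exact: (integrable_lty _ (integrableD _ i2 iw)).
Qed.

End L2loc.

(** * C^1 cutoff functions approximating the indicator of an interval *)

Section bump.
Context {R : realType}.
Local Notation mu := (@lebesgue_measure R).

(** Squaring the positive part makes it C^1, which is all the regularity that [C1c] asks of a test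
    function. *)
Definition sqpos (t : R) : R := Num.max 0 t ^+ 2.

Lemma is_derive_sqpos (t : R) : is_derive t (1 : R) sqpos (2 * Num.max 0 t).
Proof.
have [t0|t0|->] := ltgtP t 0.
- rewrite mulr0.
  apply: (@near_eq_is_derive _ _ _ (cst 0)) => //.
  near=> s; rewrite /sqpos /= max_l ?expr0n//.
  by apply: ltW; near: s; exact: lt_nbhsl.
- apply: (@near_eq_is_derive R R R (fun s : R => s ^+ 2 : R)).
    near=> s; rewrite /sqpos /= max_r//.
    by apply: ltW; near: s; exact: lt_nbhsr.
  by apply: is_derive_eq; rewrite /GRing.scale/=; ring.
- have key : h^-1 *: (sqpos (h *: 1 + 0) - sqpos 0) @[h --> (0:R)^'] --> (2 * 0 : R).
    rewrite mulr0; apply/cvgrPdist_le => e e0; near=> h.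
    rewrite sub0r normrN addr0 /sqpos maxxx expr0n subr0 /GRing.scale/= mulr1 normrM normfV.
    have h0 : h != 0 by near: h; exact: nbhs_dnbhs_neq.
    have he : `|h| <= e.
      near: h; apply: dnbhs0_le => //.
    rewrite ler_pdivrMl ?normr_gt0// normrX expr2 (le_trans _ (ler_wpM2l _ he))//.
    have mh : `|Num.max 0 h| <= `|h|.
      by rewrite maxEle; case: ifP => // _; rewrite normr0.
    by rewrite ler_pM.
  split; first by apply/cvg_ex; eexists; exact: key.
  exact/cvg_lim.
Unshelve. all: by end_near. Qed.

Lemma sqpos_ge0 t : 0 <= sqpos t. Proof. exact: sqr_ge0. Qed.

Lemma sqpos_gt0 t : 0 < t -> 0 < sqpos t.
Proof. by move=> t0; rewrite /sqpos max_r ?ltW// exprn_gt0. Qed.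

Lemma sqpos_le0 t : t <= 0 -> sqpos t = 0.
Proof. by move=> t0; rewrite /sqpos max_l// expr0n. Qed.

Variables (a b : R).

Definition hat t := sqpos (t - a) * sqpos (b - t).

Definition hat' t := 2 * Num.max 0 (t - a) * sqpos (b - t) -
  sqpos (t - a) * (2 * Num.max 0 (b - t)).

Lemma is_derive_hat t : is_derive t (1 : R) hat (hat' t).
Proof.
have da : is_derive t (1 : R) (fun s => s - a) 1.
  by apply: is_derive_eq; rewrite subr0.
have db : is_derive t (1 : R) (fun s => b - s) (-1).
  apply: is_derive_eq. by ring.
have d1 := @is_derive1_comp R sqpos (fun s => s - a) t _ _ (is_derive_sqpos _) da.
have d2 := @is_derive1_comp R sqpos (fun s => b - s) t _ _ (is_derive_sqpos _) db.
have d3 : is_derive t (1 : R) hat _ := is_deriveM d1 d2.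
apply: (is_derive_eq d3).
by rewrite /hat' /GRing.scale/=; ring.
Qed.

Lemma hat_ge0 t : 0 <= hat t.
Proof. by rewrite mulr_ge0 ?sqpos_ge0. Qed.

Lemma hat_gt0 t : a < t < b -> 0 < hat t.
Proof. by move=> /andP[? ?]; rewrite mulr_gt0 ?sqpos_gt0 ?subr_gt0. Qed.

Lemma hat_eq0 t : ~~ (a < t < b) -> hat t = 0.
Proof.
rewrite negb_and -!leNgt => /orP[ta|tb]; rewrite /hat.
  by rewrite sqpos_le0 ?mul0r// subr_le0.
by rewrite mulrC sqpos_le0 ?mul0r// subr_le0.
Qed.

Lemma continuous_hat : continuous hat.
Proof. by move=> t; apply: is_derive_continuous (is_derive_hat t). Qed.

Lemma continuous_hat' : continuous hat'.
Proof.
have cM (f : R -> R) : continuous f -> continuous (fun t => Num.max 0 (f t)).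
  move=> cf t; apply: (@continuous_max _ _ (fun=> 0) f t); [exact: cvg_cst|exact: cf].
have c1 : continuous (fun t : R => t - a).
  by move=> t; apply: cvgB; [exact: cvg_id|exact: cvg_cst].
have c2 : continuous (fun t : R => b - t).
  by move=> t; apply: cvgB; [exact: cvg_cst|exact: cvg_id].
have sqM (f : R -> R) : continuous f -> continuous (fun t => sqpos (f t)).
  move=> cf t; rewrite /sqpos; exact: (cvgM (cM _ cf t) (cM _ cf t)).
move=> t; apply: cvgB.
  apply: cvgM; last exact: (sqM _ c2 t).
  by apply: cvgM; [exact: cvg_cst|exact: (cM _ c1 t)].
apply: cvgM; first exact: (sqM _ c1 t).
by apply: cvgM; [exact: cvg_cst|exact: (cM _ c2 t)].
Qed.

(** Since x / (1 + x) maps [0, +oo[ to [0, 1[ and tends to 1 at +oo, these functions tend pointwise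
    to the indicator of ]a, b[ while remaining C^1, without mollification. *)
Definition cutoff (n : nat) (t : R) : R := n%:R * hat t / (1 + n%:R * hat t).

Let den_gt0 n t : 0 < 1 + n%:R * hat t.
Proof. by rewrite ltr_wpDr// mulr_ge0// hat_ge0. Qed.

Lemma cutoff_itv n t : 0 <= cutoff n t <= 1.
Proof.
have d0 := den_gt0 n t; apply/andP; split.
  by rewrite divr_ge0 ?(ltW d0)// mulr_ge0// hat_ge0.
by rewrite ler_pdivrMr// mul1r lerDr.
Qed.

Lemma cutoff_eq0 n t : ~~ (a < t < b) -> cutoff n t = 0.
Proof. by move=> h; rewrite /cutoff hat_eq0// mulr0 mul0r. Qed.

Lemma cvg_cutoff t : a < t < b -> cutoff n t @[n --> \oo] --> (1 : R).
Proof.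
move=> tab; have h0 := hat_gt0 tab.
apply/cvgrPdist_le => e e0; near=> n.
have -> : 1 - cutoff n t = (1 + n%:R * hat t)^-1.
  by have dN0 := lt0r_neq0 (den_gt0 n t); rewrite /cutoff; field.
have d0 := den_gt0 n t.
rewrite ger0_norm ?invr_ge0 ?(ltW d0)// invf_ple ?posrE//.
have : e^-1 / hat t < n%:R by near: n; exact: nbhs_infty_gtr.
by rewrite ltr_pdivrMr// => /ltW; set x := _ * hat t; lra.
Unshelve. all: by end_near. Qed.

Lemma is_derive_cutoff n t : is_derive t (1 : R) (cutoff n)
  (n%:R * hat' t / (1 + n%:R * hat t) ^+ 2).
Proof.
have dN0 := lt0r_neq0 (den_gt0 n t).
have ? := is_derive_hat t.
have dd : is_derive t (1:R) (fun s => 1 + n%:R * hat s) (n%:R * hat' t).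
  by apply: is_derive_eq; rewrite /GRing.scale/=; ring.
have di : is_derive t (1:R) (fun s => (1 + n%:R * hat s)^-1)
   (- (1 + n%:R * hat t) ^- 2 *: (n%:R * hat' t)).
  exact: is_deriveV.
have -> : cutoff n = (fun s => n%:R * hat s * (1 + n%:R * hat s)^-1) by [].
apply: is_derive_eq; rewrite /GRing.scale/=.
by field.
Qed.

Lemma C1c_cutoff n : C1c setT (cutoff n : R -> R^o).
Proof.
have sub : closure [set t | cutoff n t != 0] `<=` `[a, b]%classic.
  rewrite [X in _ `<=` X](_ : _ = closure `[a, b]%classic); last first.
    exact/closure_id/itv_closed.
  apply: closure_subset => t /= ct; rewrite in_itv/=.
  have : a < t < b by apply: contraNT ct => /cutoff_eq0 ->.
  by move=> /andP[/ltW -> /ltW ->].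
split => //.
- by move=> t; have [] := is_derive_cutoff n t.
- rewrite (_ : derive1 _ = fun t => n%:R * hat' t / (1 + n%:R * hat t) ^+ 2); last first.
    apply/funext => t; rewrite derive1E.
    by have := is_derive_cutoff n t => -[].
  move=> t; apply: cvgM.
    by apply: cvgM; [exact: cvg_cst|exact: continuous_hat'].
  apply: cvgV; first by rewrite expf_neq0// lt0r_neq0.
  have cd : {for t, continuous (fun t => 1 + n%:R * hat t)}.
    apply: cvgD; first exact: cvg_cst.
    by apply: cvgM; [exact: cvg_cst|exact: continuous_hat].
  exact: (cvgM cd cd).
- by apply: (subclosed_compact _ (@segment_compact _ a b)) => //; exact: closed_closure.
Qed.

End bump.

(** * The du Bois-Reymond lemma on the real line *)

Section dubois_reymond.
Context {R : realType}.
Local Notation mu := (@lebesgue_measure R).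
Variable f : R -> R.
Hypothesis lf : locally_integrable setT f.

Lemma locally_integrable_itv (a b : R) : mu.-integrable `[a, b] (EFin \o f).
Proof.
have [mf _ fK] := lf.
apply/integrableP; split; last exact: fK (@segment_compact _ a b).
exact/measurable_EFinP/(measurable_funS measurableT).
Qed.

Hypothesis f0 : forall phi : R -> R^o, C1c setT phi ->
  (\int[mu]_t (phi t * f t)%:E)%E = 0%E.

(** Test [f0] with the cutoffs and pass to the limit by dominated convergence, with dominating
    function |f| on ]a, b[. *)
Lemma integral_itv_eq0 (a b : R) : (\int[mu]_(t in `]a, b[) (f t)%:E)%E = 0%E.
Proof.
have [mf _ _] := lf.
have mab : measurable (`]a, b[%classic : set R) by exact: measurable_itv.
have iab : mu.-integrable `]a, b[ (EFin \o f).
  apply: (integrableS _ _ _ (locally_integrable_itv a b)) => //.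
  by move=> t /=; rewrite !in_itv/= => /andP[/ltW -> /ltW ->].
have mcut n : measurable_fun (`]a, b[%classic : set R) (cutoff a b n).
  apply: (measurable_funS measurableT) => //.
  apply: continuous_measurable_fun => t.
  exact: is_derive_continuous (is_derive_cutoff a b n t).
have [||||| _ _] := @dominated_convergence _ _ R mu `]a, b[%classic mab
  (fun n t => (cutoff a b n t * f t)%:E) (EFin \o f) (fun t => `|f t|%:E).
- move=> n; apply/measurable_EFinP; apply: measurable_funM => //.
    exact: mcut.
  by apply: (measurable_funS measurableT).
- exact/measurable_EFinP/(measurable_funS measurableT).
- apply: aeW => t; rewrite /= in_itv/= => tab.
  apply: cvg_EFin; first by near=> n.
  rewrite -[X in _ --> X]mul1r; apply: cvgM; last exact: cvg_cst.
  exact: cvg_cutoff.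
- exact: (integrable_abse iab).
- apply: aeW => t n _ /=.
  rewrite lee_fin normrM ler_piMl//.
  by have /andP[h0 h1] := cutoff_itv a b n t; rewrite ger0_norm.
have -> : [sequence (\int[mu]_(x in `]a, b[) (cutoff a b n x * f x)%:E)%E]_n = (fun=> 0%E).
  apply/funext => n; rewrite -[RHS](f0 (C1c_cutoff a b n)) [LHS]/= [LHS]integral_mkcond.
  apply: eq_integral => t _; rewrite patchE; case: ifPn => // /negP h.
  rewrite cutoff_eq0 ?mul0r//; apply/negP => tab; apply: h.
  by rewrite inE/= in_itv.
move=> h; have /cvg_lim := h; rewrite lim_cst//.
by move=> /(_ (@ereal_hausdorff R)).
Unshelve. all: by end_near.
Qed.

(** At a Lebesgue point t, the primitive of f based at t - 1 has derivative f t; but all its values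
    vanish. The base point is near t because f is only locally integrable. *)
Lemma dubois_reymond : {ae mu, forall t, f t = 0}.
Proof.
have := lebesgue_differentiation lf.
apply: filterS; first exact: (ae_filter_ringOfSetsType mu).
move=> t lt.
have tt : (t < t + 1) by rewrite ltrDl.
have t1t : (BRight (t - 1) < BRight t)%O by rewrite bnd_simp ltrBlDr ltrDl.
have i1 : mu.-integrable [set` Interval (BRight (t - 1)) (BRight (t + 1))] (EFin \o f).
  apply: (integrableS _ _ _ (locally_integrable_itv (t - 1) (t + 1))) => //.
  by move=> x /=; rewrite !in_itv/= => /andP[/ltW -> ->].
have [_ <-] := FTC1_lebesgue_pt tt i1 t1t lt.
rewrite (_ : (fun y => _) = cst 0) ?derive1_cst//.
apply/funext => y; rewrite /Rintegral -integral_itv_bndo_bndc ?integral_itv_eq0//.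
have [mf _ _] := lf.
exact/measurable_EFinP/(measurable_funS measurableT).
Qed.

End dubois_reymond.

(** * Test functions: support and integrability against local functions *)

Section test_functions.
Context {R : realType}.
Local Notation mu := (@lebesgue_measure R).
Variable phi : R -> R^o.
Hypothesis hphi : C1c setT phi.

Lemma C1c_is_derive t : is_derive t (1 : R) (phi : R -> R) (derive1 phi t).
Proof. by have [d _ _ _] := hphi; rewrite derive1E; exact: derivableP. Qed.

Lemma C1c_continuous : continuous (phi : R -> R).
Proof. move=> t; exact: is_derive_continuous (C1c_is_derive t). Qed.

Lemma C1c_support : exists M : R, forall t, M < `|t| -> phi t = 0 /\ derive1 phi t = 0.
Proof.
have [_ _ cK _] := hphi.
have [M [_ hM]] := compact_bounded cK.
have phi0 t : M + 1 < `|t| -> phi t = 0.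
  move=> Mt; apply/eqP; apply: contraLR Mt => pt; rewrite -leNgt.
  by apply: (hM (M + 1)); rewrite ?ltrDl//; exact: subset_closure.
exists (M + 1) => t Mt; split; first exact: phi0.
rewrite derive1E.
suff -> : 'D_1 phi t = 'D_1 (cst 0 : R -> R^o) t by rewrite derive_cst.
apply: near_eq_derive; near=> s; rewrite phi0//.
near: s; apply: (cvgr_gt _ (cvg_norm cvg_id)) => //.
Unshelve. all: by end_near. Qed.

Lemma C1cM_integrable (h : R -> R) : locally_integrable setT h ->
  mu.-integrable setT (fun t => (phi t * h t)%:E).
Proof.
move=> lh; have [M hM] := C1c_support; pose N := Num.max 0 M + 1.
have sup t : t \notin `[- N, N] -> phi t = 0.
  move=> tN; apply: (hM t _).1; rewrite ltNge; apply: contra tN => tM.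
  rewrite in_itv/= -ler_norml; apply: le_trans tM _.
  by rewrite /N (le_trans (_ : _ <= Num.max 0 M))// ?le_max ?lexx ?orbT// lerDl.
have [mh _ _] := lh.
have -> : (fun t => (phi t * h t)%:E) = (fun t => (phi t * h t)%:E) \_ `[- N, N]%classic.
  apply/funext => t; rewrite patchE; case: ifPn => // tN.
  by rewrite sup ?mul0r//; apply: contra tN; rewrite inE.
rewrite -integrable_mkcond//.
have [b [_ bP]] : bounded_set (phi @` `[- N, N]%classic).
  apply: compact_bounded; apply: continuous_compact; last exact: segment_compact.
  by apply: continuous_subspaceT; exact: C1c_continuous.
apply: (@le_integrable _ _ _ mu _ _ _ (fun t => ((Num.max 0 b + 1) * h t)%:E)) => //.
- apply/measurable_EFinP; apply: measurable_funM.
    apply: (measurable_funS measurableT) => //.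
    by apply: continuous_measurable_fun; exact: C1c_continuous.
  exact: (measurable_funS measurableT).
- move=> t tN; rewrite lee_fin !normrM ler_wpM2r//.
  have b1 : b < Num.max 0 b + 1.
    by rewrite (@le_lt_trans _ _ (Num.max 0 b))// ?le_max ?lexx ?orbT// ltrDl.
  apply: le_trans (ler_norm _); apply: (bP _ b1); by exists t.
- rewrite (_ : (fun t => _) = (fun t => (Num.max 0 b + 1)%:E * (EFin \o h) t)%E);
    last by apply/funext => t; rewrite EFinM.
  apply: integrableZl => //; exact: locally_integrable_itv.
Qed.

End test_functions.

(** * Almost everywhere uniqueness of weak derivatives *)

Section weak_derivative.
Context {R : realType} {V : normedModType R}.
Local Notation mu := (@lebesgue_measure R).
Variable ip : {dot V for (idfun : R -> R)}.
Hypothesis ipE : forall v, ip v v = `|v| ^+ 2.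

(** For each w, the du Bois-Reymond lemma gives <g1 - g2, w> = 0 outside a null set that depends on
    w. Simple curves converging to g1 - g2 take countably many values altogether, so a single null
    set serves for all of them. Outside it, testing with the approximations at t and passing to the
    limit gives |g1 t - g2 t|^2 = 0. *)
Lemma weak_derivative_unique (u g1 g2 : R -> V) :
  L2loc setT g1 -> L2loc setT g2 ->
  weak_derivative ip setT u g1 -> weak_derivative ip setT u g2 ->
  {ae mu, forall t, g1 t = g2 t}.
Proof.
move=> L1 L2 w1 w2.
have dw w : {ae mu, forall t, ip (g1 t - g2 t) w = 0}.
  have l1 := L2loc_locally_integrable ipE w L1.
  have l2 := L2loc_locally_integrable ipE w L2.
  have h := @dubois_reymond R _ (locally_integrableB l1 l2).
  suff /h : forall phi : R -> R^o, C1c setT phi ->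
      (\int[mu]_t (phi t * (ip (g1 t) w - ip (g2 t) w))%:E)%E = 0%E.
    apply: filterS; first exact: (ae_filter_ringOfSetsType mu).
    by move=> t /= <-; rewrite dotBl.
  move=> phi hphi.
  have hphi' : C1c [set: R]° phi by rewrite interiorT.
  have i1 := C1cM_integrable hphi l1.
  have i2 := C1cM_integrable hphi l2.
  have := w1 _ hphi' w; rewrite (w2 _ hphi' w) => /eqP; rewrite eqe_opp => /eqP e12.
  under eq_integral do rewrite mulrBr EFinB.
  by rewrite integralB_EFin// e12 subee// integrable_fin_num.
have [s [ss sd]] := strongly_measurableB L1.1 L2.1.
have fsP n : exists l : seq V, range (s n) = [set` l] by apply/finite_seqP; exact: (ss n).1.
have [l lE] := choice fsP.
have hl (r : seq V) : {ae mu, forall t, forall y, y \in r -> ip (g1 t - g2 t) y = 0}.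
  elim: r => [|y r IH]; first exact: aeW.
  move: (dw y) IH; apply: filterS2; first exact: (ae_filter_ringOfSetsType mu).
  move=> t ty tr z.
  by rewrite inE => /predU1P[->|/tr].
have := @ae_foralln _ _ _ mu _ (fun n => hl (l n)).
apply: filterS.
move=> t ht.
apply/eqP; rewrite -subr_eq0 -normr_eq0 -sqrf_eq0 -ipE; apply/eqP.
have hc : (fun _ : nat => g1 t - g2 t) @ \oo --> g1 t - g2 t by exact: cvg_cst.
have := @cvg_dot _ _ ip ipE _ _ eventually_filter _ _ _ _ hc (sd t I).
rewrite (_ : (fun n => _) = cst 0); last first.
  apply/funext => n; apply: (ht n).
  suff : [set` l n] (s n t) by [].
  by rewrite -lE; exists t.
by move=> /cvg_lim <- //; rewrite lim_cst.
Qed.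

End weak_derivative.

(** * Integrals of derivatives and of functions glued at one point *)

Section piecewise_integrals.
Context {R : realType}.
Local Notation mu := (@lebesgue_measure R).

Lemma is_derive_LRcontinuous (F f : R -> R) (a b : R) :
  (forall t, is_derive t (1 : R) F (f t)) -> derivable_oo_LRcontinuous F a b.
Proof.
move=> dF; have cF t : {for t, continuous F} := is_derive_continuous (dF t).
split; first by move=> t _; have [] := dF t.
- exact/cvg_at_right_filter/cF.
- exact/cvg_at_left_filter/cF.
Qed.

Lemma is_derive_derive1 (V : normedModType R) (F f : R -> V) t :
  is_derive t (1 : R) F (f t) -> F^`()%classic t = f t.
Proof. by move=> [_ dF]; rewrite derive1E. Qed.

Lemma integral_is_derive (F f : R -> R) (a b : R) : a < b -> continuous f ->
  (forall t, is_derive t (1 : R) F (f t)) ->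
  (\int[mu]_(t in `[a, b]) (f t)%:E = (F b - F a)%:E)%E.
Proof.
move=> ab cf dF; rewrite (@continuous_FTC2 _ _ F _ _ ab) ?EFinB//.
- exact: continuous_subspaceT.
- exact: is_derive_LRcontinuous dF.
- by move=> t _; exact: is_derive_derive1.
Qed.

Lemma continuous_itv_integrable (h : R -> R) (a b : R) : continuous h ->
  mu.-integrable `[a, b] (EFin \o h).
Proof.
move=> ch; apply: continuous_compact_integrable; first exact: segment_compact.
exact: continuous_subspaceT.
Qed.

Lemma measurable_piecewise (h1 h2 : R -> R) (t0 : R) :
  measurable_fun setT h1 -> measurable_fun setT h2 ->
  measurable_fun setT (fun t : R => if t <= t0 then h1 t else h2 t).
Proof.
move=> m1 m2; apply: measurable_fun_ifT => //.
exact: measurable_fun_ler.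
Qed.

Lemma integral_piecewise (h1 h2 : R -> R) (N t0 : R) :
  continuous h1 -> continuous h2 -> - N < t0 < N ->
  (forall t, N < `|t| -> h1 t = 0 /\ h2 t = 0) ->
  (\int[mu]_t (if t <= t0 then h1 t else h2 t)%:E =
  \int[mu]_(t in `[(- N)%R, t0]) (h1 t)%:E + \int[mu]_(t in `[t0, N]) (h2 t)%:E)%E.
Proof.
move=> c1 c2 /andP[Nt tN] h0.
set h := fun t => if t <= t0 then h1 t else h2 t.
have mh : measurable_fun setT h.
  by apply: measurable_piecewise; exact: continuous_measurable_fun.
transitivity (\int[mu]_(t in `[(- N)%R, N]) (h t)%:E)%E.
  rewrite [RHS]integral_mkcond; apply: eq_integral => t _.
  rewrite patchE; have [//|tN'] := boolP (t \in `[- N, N]%classic).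
  have [-> ->] : h1 t = 0 /\ h2 t = 0; last by rewrite if_same.
  apply: h0; rewrite ltNge; apply: contra tN'.
  by rewrite inE/= in_itv/= -ler_norml.
have -> : `[- N, N]%classic = `[- N, t0]%classic `|` `]t0, N]%classic.
  apply/seteqP; split => t /=; rewrite !in_itv/=.
    by move=> /andP[-> ->]; rewrite ?andbT /=; have [?|?] := leP t t0; [left|right].
  by case=> /andP[h3 h4]; rewrite ?h3 ?h4 ?andbT/=; lra.
rewrite integral_setU//=.
- congr (_ + _)%E.
    by apply: eq_integral => t; rewrite inE/= in_itv/= => /andP[_ tt]; rewrite /h tt.
  rewrite -integral_itv_obnd_cbnd.
    apply: eq_integral => t; rewrite inE/= in_itv/= => /andP[tt _].
    by rewrite /h leNgt tt.
  apply/measurable_EFinP; apply: (measurable_funS measurableT) => //.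
  exact: continuous_measurable_fun.
- by apply/measurable_EFinP; apply: (measurable_funS measurableT).
- apply/disj_setPS => t /=; rewrite !in_itv/= => -[/andP[_ h3] /andP[h4 _]].
  by have := lt_le_trans h4 h3; rewrite ltxx.
Qed.

End piecewise_integrals.

(** * Weak derivative of two C^1 curves glued at one point *)

Section piecewise.
Context {R : realType} {V : normedModType R}.
Local Notation mu := (@lebesgue_measure R).
Variable ip : {dot V for (idfun : R -> R)}.
Hypothesis ipE : forall v, ip v v = `|v| ^+ 2.
Variables (u1 u2 g1 g2 : R -> V) (t0 : R).
Hypothesis (du1 : forall t, is_derive t (1 : R) u1 (g1 t)).
Hypothesis (du2 : forall t, is_derive t (1 : R) u2 (g2 t)).
Hypothesis (cg1 : continuous g1) (cg2 : continuous g2).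
Hypothesis u12 : u1 t0 = u2 t0.

Definition piecewise (v1 v2 : R -> V) (t : R) := if t <= t0 then v1 t else v2 t.

Lemma continuous_piecewise : continuous (piecewise u1 u2).
Proof.
have c1 t : {for t, continuous u1} := is_derive_continuous (du1 t).
have c2 t : {for t, continuous u2} := is_derive_continuous (du2 t).
move=> t; have [tt|tt|tt] := ltgtP t t0.
- rewrite /continuous_at /piecewise (ltW tt).
  apply: cvg_trans (c1 t); apply: near_eq_cvg; near=> s.
  by have /ltW -> : s < t0 by near: s; exact: lt_nbhsl.
- rewrite /continuous_at /piecewise leNgt tt/=.
  apply: cvg_trans (c2 t); apply: near_eq_cvg; near=> s.
  by have st : t0 < s; [near: s; exact: lt_nbhsr|rewrite leNgt st].
- subst t; apply/cvgrPdist_lt => e e0; rewrite /piecewise lexx.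
  have /cvgrPdist_lt/(_ e e0) h1 := c1 t0.
  have /cvgrPdist_lt/(_ e e0) h2 := c2 t0.
  near=> s; case: ifP => _; first by near: s.
  by rewrite u12; near: s.
Unshelve. all: by end_near. Qed.

Lemma piecewise_strongly_measurable : strongly_measurable setT (piecewise g1 g2).
Proof.
apply: strongly_measurable_piecewise; try exact: continuous_strongly_measurable.
have -> : [set t | t <= t0] = `]-oo, t0]%classic.
  by apply/seteqP; split => t /=; rewrite in_itv.
exact: measurable_itv.
Qed.

Lemma piecewise_L2loc : L2loc setT (piecewise g1 g2).
Proof.
apply: (L2loc_le (b := fun t => `|g1 t| ^+ 2 + `|g2 t| ^+ 2)).
- exact: piecewise_strongly_measurable.
- have c (g : R -> V) : continuous g -> continuous (fun t => `|g t| ^+ 2).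
    by move=> cg t; exact: (cvg_comp _ _ (cg t) (@continuous_sqr_norm _ _ (g t))).
  by move=> t; exact: (cvgD (c _ cg1 t) (c _ cg2 t)).
- by move=> t; rewrite /piecewise; case: ifP => _; rewrite ?lerDl ?lerDr sqr_ge0.
Qed.

(** Integrate by parts on each side of t0: the boundary terms at t0 cancel by [u12], and those at -N
    and N vanish, N lying beyond the support of the test function. *)
Lemma piecewise_weak_derivative : weak_derivative ip setT (piecewise u1 u2) (piecewise g1 g2).
Proof.
move=> phi; rewrite interiorT => hphi w.
have [M hM] := C1c_support hphi.
have dphi := C1c_is_derive hphi.
have cphi := C1c_continuous hphi.
have cdphi : continuous (derive1 phi : R -> R) by have [] := hphi.
pose N := Num.max M `|t0| + 1.
have MN : M < N by rewrite (@le_lt_trans _ _ (Num.max M `|t0|))// ?le_max ?lexx// ltrDl.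
have tN : - N < t0 < N.
  rewrite -ltr_norml (@le_lt_trans _ _ (Num.max M `|t0|))// ?le_max ?lexx ?orbT//.
  by rewrite ltrDl.
have MN0 t : N <= `|t| -> phi t = 0 /\ derive1 phi t = 0.
  by move=> Nt; apply: hM; apply: lt_le_trans Nt.
have N0 : 0 <= N.
  by rewrite addr_ge0// le_max normr_ge0 orbT.
have phiN : phi N = 0 by apply: (MN0 _ _).1; rewrite ger0_norm.
have phiNN : phi (- N) = 0 by apply: (MN0 _ _).1; rewrite normrN ger0_norm.
have df u g : (forall t, is_derive t (1 : R) u (g t)) ->
    forall t, is_derive t (1 : R) (fun t => ip (u t) w) (ip (g t) w).
  move=> du t; have h := is_derive_dot ipE (du t) (is_derive_cst w t (1 : R)).
  by apply: (is_derive_eq h); rewrite /cst raddf0 addr0.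
have cip (u : R -> V) : continuous u -> continuous (fun t => ip (u t) w).
  move=> cu t; have hc : (fun _ : R => w) @ t --> w by exact: cvg_cst.
  exact: (@cvg_dot _ _ ip ipE _ _ (nbhs_filter t) _ _ _ _ (cu t) hc).
have cu1 : continuous u1 by move=> t; exact: is_derive_continuous (du1 t).
have cu2 : continuous u2 by move=> t; exact: is_derive_continuous (du2 t).
have cM (h k : R -> R) : continuous h -> continuous k -> continuous (fun t => h t * k t).
  by move=> ch ck t; apply: cvgM; [exact: ch|exact: ck].
have -> : (\int[mu]_t (derive1 phi t * ip (piecewise u1 u2 t) w)%:E =
  \int[mu]_t (if t <= t0 then derive1 phi t * ip (u1 t) w else derive1 phi t * ip (u2 t) w)%:E)%E.
  by apply: eq_integral => t _; rewrite /piecewise; case: ifP.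
have -> : (\int[mu]_t (phi t * ip (piecewise g1 g2 t) w)%:E =
  \int[mu]_t (if t <= t0 then phi t * ip (g1 t) w else phi t * ip (g2 t) w)%:E)%E.
  by apply: eq_integral => t _; rewrite /piecewise; case: ifP.
rewrite (@integral_piecewise _ _ _ N t0) ?(@integral_piecewise _ _ _ N t0)//; last 6 first.
- by apply: cM => //; exact: cip.
- by apply: cM => //; exact: cip.
- by move=> t /ltW /MN0[-> _]; rewrite !mul0r.
- by apply: cM => //; exact: cip.
- by apply: cM => //; exact: cip.
- by move=> t /ltW /MN0[_ ->]; rewrite !mul0r.
have parts u g a b : a < b -> (forall t, is_derive t (1 : R) u (g t)) -> continuous g ->
  (\int[mu]_(t in `[a, b]) (derive1 phi t * ip (u t) w)%:E =
   (phi b * ip (u b) w - phi a * ip (u a) w)%:E -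
   \int[mu]_(t in `[a, b]) (phi t * ip (g t) w)%:E)%E.
  move=> ab du cg.
  have cu : continuous u by move=> t; exact: is_derive_continuous (du t).
  have i1 := @continuous_itv_integrable _ (fun t => derive1 phi t * ip (u t) w) a b
    (cM _ _ cdphi (cip _ cu)).
  have i2 := @continuous_itv_integrable _ (fun t => phi t * ip (g t) w) a b
    (cM _ _ cphi (cip _ cg)).
  have E : (\int[mu]_(t in `[a, b]) (derive1 phi t * ip (u t) w + phi t * ip (g t) w)%:E =
      (phi b * ip (u b) w - phi a * ip (u a) w)%:E)%E.
    apply: (@integral_is_derive R (fun t => phi t * ip (u t) w)) => //.
    - move=> t; exact: (cvgD (cM _ _ cdphi (cip _ cu) t) (cM _ _ cphi (cip _ cg) t)).
    - move=> t; have h1 := dphi t; have h2 := df _ _ du t.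
      apply: (is_derive_eq (is_deriveM h1 h2)).
      by rewrite /GRing.scale/=; ring.
  rewrite -E.
  under [X in (_ = X - _)%E]eq_integral do rewrite EFinD.
  by rewrite (integralD_EFin _ i1 i2)// addeK// integrable_fin_num.
move: tN => /andP[tN1 tN2].
rewrite (parts _ _ _ _ tN1 du1 cg1) (parts _ _ _ _ tN2 du2 cg2).
rewrite phiN phiNN !mul0r subr0 sub0r u12.
have := integrable_fin_num _ (@continuous_itv_integrable _
  (fun t => phi t * ip (g1 t) w) (- N) t0 (cM _ _ cphi (cip _ cg1))).
have := integrable_fin_num _ (@continuous_itv_integrable _
  (fun t => phi t * ip (g2 t) w) t0 N (cM _ _ cphi (cip _ cg2))).
move=> /(_ (measurable_itv _)) /fineK/= <- /(_ (measurable_itv _)) /fineK/= <-.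
rewrite -!EFinB -!EFinD -EFinN; congr EFin.
by ring.
Qed.

Lemma piecewise_H1loc : H1loc ip setT (piecewise u1 u2).
Proof.
split.
- exact/continuous_subspaceT/continuous_piecewise.
- apply: (L2loc_le (b := fun t => `|piecewise u1 u2 t| ^+ 2)) => //.
    exact/continuous_strongly_measurable/continuous_piecewise.
  by move=> t; exact: (cvg_comp _ _ (@continuous_piecewise t) (@continuous_sqr_norm _ _ _)).
- by exists (piecewise g1 g2); split; [exact: piecewise_L2loc|exact: piecewise_weak_derivative].
Qed.

(** [wderiv] is an arbitrary choice among weak derivatives, so uniqueness is what identifies it with
    the explicit one, and only almost everywhere. *)
Lemma piecewise_wderiv : {ae mu, forall t, wderiv ip setT (piecewise u1 u2) t = piecewise g1 g2 t}.
Proof.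
have : [set g | L2loc setT g /\ weak_derivative ip setT (piecewise u1 u2) g] !=set0.
  by exists (piecewise g1 g2); split; [exact: piecewise_L2loc|exact: piecewise_weak_derivative].
move=> /(xgetPex (fun=> 0)) [l w].
exact: (weak_derivative_unique ipE l piecewise_L2loc w piecewise_weak_derivative).
Qed.

Lemma wderiv_strongly_measurable : strongly_measurable setT (wderiv ip setT (piecewise u1 u2)).
Proof.
have : [set g | L2loc setT g /\ weak_derivative ip setT (piecewise u1 u2) g] !=set0.
  by exists (piecewise g1 g2); split; [exact: piecewise_L2loc|exact: piecewise_weak_derivative].
by move=> /(xgetPex (fun=> 0)) [[]].
Qed.

End piecewise.

(** * Comparison of weighted energies *)

Section exponential_ray.
Context {R : realType}.
Local Notation mu := (@lebesgue_measure R).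
Variables (r t : R).
Hypothesis r0 : 0 < r.

Lemma cvg_expRM_y : expR (- (r * x)) @[x --> +oo] --> (0 : R).
Proof.
apply: (@cvg_comp _ _ _ (fun x : R => r * x) (fun y => expR (- y)) _ +oo).
  by apply: gt0_cvgMry => //; exact: cvg_id.
exact: cvgr_expR.
Qed.

Lemma integral_expR_ray :
  (\int[mu]_(x in `]-oo, t]) (expR (r * x))%:E = (expR (r * t) / r)%:E)%E.
Proof.
have cexp : continuous (fun x : R => expR (r * x)).
  by move=> x; exact: is_derive_continuous (is_derive_expRM r x).
rewrite -[t in LHS]opprK.
rewrite (@ge0_integration_by_substitutionNy _ (fun x => expR (r * x)) (- t));
  last 2 first.
- exact: continuous_subspaceT.
- by move=> x _; exact: expR_ge0.
pose F x := - (expR (- r * x) / r).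
have dF x : is_derive x (1 : R) F (expR (r * (- x))).
  have ? := is_derive_expRM (- r) x.
  apply: is_derive_eq; rewrite /GRing.scale/=.
  have rN0 := lt0r_neq0 r0; rewrite (_ : r * - x = - r * x); last by ring.
  by field.
have cF x : {for x, continuous F} := is_derive_continuous (dF x).
rewrite (@ge0_continuous_FTC2y _ _ F _ 0).
- by rewrite /F sub0e -EFinN opprK mulrNN.
- by move=> x _; exact: expR_ge0.
- apply: continuous_subspaceT => x.
  rewrite (_ : _ \o _ = fun x => expR (- r * x)).
    exact: is_derive_continuous (is_derive_expRM (- r) x).
  by apply/funext => y /=; rewrite mulrN mulNr.
- rewrite -oppr0 -(mul0r r^-1); apply: cvgN; apply: cvgM; last exact: cvg_cst.
  under eq_fun do rewrite mulNr.
  exact: cvg_expRM_y.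
- by move=> x _; have [] := dF x.
- exact/cvg_at_right_filter/cF.
- by move=> x _; exact: is_derive_derive1.
Qed.

(** With r = c and k = - a it dominates the negative part of an energy density; with r = 2 + c it
    bounds the cost of the competitor. *)
Definition ray_exp (k x : R) := if x <= t then k * expR (r * x) else 0.

Let rayE : [set x | x <= t] = `]-oo, t]%classic :> set R.
Proof. by apply/seteqP; split => x /=; rewrite in_itv. Qed.

Lemma measurable_ray_exp k : measurable_fun setT (ray_exp k).
Proof.
apply: (@measurable_piecewise _ (fun x => k * expR (r * x)) (cst 0)) => //.
apply: measurable_funM => //; apply: continuous_measurable_fun => x.
exact: is_derive_continuous (is_derive_expRM r x).
Qed.

Lemma ray_exp_integral k : 0 <= k ->
  mu.-integrable setT (EFin \o ray_exp k) /\
  (\int[mu]_x ray_exp k x)%R = k * expR (r * t) / r.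
Proof.
move=> k0.
have E : (\int[mu]_x (ray_exp k x)%:E = (k * expR (r * t) / r)%:E)%E.
  transitivity (\int[mu]_(x in `]-oo, t]) (k%:E * (expR (r * x))%:E))%E.
    rewrite [RHS]integral_mkcond; apply: eq_integral => x _.
    rewrite patchE /ray_exp -rayE.
    by have [xt|xt] := leP x t; [rewrite mem_set//|rewrite memNset//= leNgt xt].
  rewrite ge0_integralZl_EFin//.
  - by rewrite integral_expR_ray -EFinM mulrA.
  - apply/measurable_EFinP; apply: (measurable_funS measurableT) => //.
    apply: continuous_measurable_fun => x.
    exact: is_derive_continuous (is_derive_expRM r x).
split; last by rewrite /Rintegral E.
apply/integrableP; split; first by apply/measurable_EFinP; exact: measurable_ray_exp.
rewrite (_ : (fun x => _) = (fun x => (ray_exp k x)%:E)) ?E ?ltry//.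
apply/funext => x /=; rewrite ger0_norm// /ray_exp.
by case: ifP => // _; rewrite mulr_ge0// expR_ge0.
Qed.

End exponential_ray.

(** * Consequences of a zero integral, alone and against a competitor *)

Section zero_integral.
Context {R : realType}.
Local Notation mu := (@lebesgue_measure R).

(** The minorant makes the negative part integrable; a finite integral then forces the positive part
    to be integrable too. *)
Lemma integrable_ge (f b : R -> R) : measurable_fun setT f ->
  mu.-integrable setT (EFin \o b) -> (forall x, 0 <= b x) ->
  (forall x, - b x <= f x) -> (\int[mu]_x (f x)%:E)%E \is a fin_num ->
  mu.-integrable setT (EFin \o f).
Proof.
move=> mf ib b0 bf.
have mf' : measurable_fun setT (EFin \o f) by exact/measurable_EFinP.
have neg : (\int[mu]_x ((EFin \o f)^\- x) < +oo)%E.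
  apply: (@le_lt_trans _ _ (\int[mu]_x (EFin \o b) x)%E); last exact: integrable_lty ib.
  apply: ge0_le_integral => //.
  - exact: measurable_funeneg.
  - by have /measurable_int := ib.
  - move=> x _; rewrite funenegE ge_max -EFinN !lee_fin b0 andbT.
    by rewrite lerNl.
rewrite integralE => fin.
have pos : (\int[mu]_x ((EFin \o f)^\+ x) < +oo)%E.
  rewrite ltey; apply/eqP => e; move: fin; rewrite e.
  have : (\int[mu]_x ((EFin \o f)^\- x))%E \is a fin_num.
    by rewrite ge0_fin_numE ?integral_ge0.
  by move=> /fineK <-.
apply/integrableP; split => //.
rewrite -[fun x => _]/(abse \o (EFin \o f)) fune_abse ge0_integralD//.
- by rewrite lte_add_pinfty.
- exact: measurable_funepos.
- exact: measurable_funeneg.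
Qed.

Variables (a c : R) (D : R -> R).
Hypothesis (a0 : a <= 0) (c0 : 0 < c).
Hypothesis mD : continuous D.
Hypothesis Da : forall x, a * expR (c * x) <= D x.
Hypothesis D0 : (\int[mu]_x (D x)%:E = 0)%E.
Variable t1 : R.
Hypothesis Dt1 : forall x, t1 < x -> 0 <= D x.

Let mD' : measurable_fun setT D. Proof. exact: continuous_measurable_fun. Qed.

Let Na0 : 0 <= - a. Proof. by rewrite oppr_ge0. Qed.

Let Dray x : - ray_exp c t1 (- a) x <= D x.
Proof.
rewrite /ray_exp; case: ifP => [_|/negbT].
  by rewrite mulNr opprK.
by rewrite -ltNge oppr0; exact: Dt1.
Qed.

Lemma zero_integral_integrable : mu.-integrable setT (EFin \o D).
Proof.
have [i _] := ray_exp_integral t1 c0 Na0.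
apply: (integrable_ge mD' i) => //; last by rewrite D0.
by move=> x; rewrite /ray_exp; case: ifP => // _; rewrite mulr_ge0// expR_ge0.
Qed.

Let itv_integrable (s t : R) (h : R -> R) : continuous h ->
  mu.-integrable setT (EFin \o (h \_ `[s, t])).
Proof.
move=> ch; rewrite -restrict_EFin -integrable_mkcond//.
exact: continuous_itv_integrable.
Qed.

(** The combined integrand is at most D + [ray_exp c t1 (- a)], which is nonnegative everywhere. As
    D has integral 0, the integral of this majorant is the right-hand side. *)
Lemma zero_integral_split (s t : R) : s < t1 < t ->
  (\int[mu]_(x in `[t1, t]) D x)%R +
  (\int[mu]_(x in `[s, t1]) (D x - a * expR (c * x)))%R <= - a * expR (c * t1) / c.
Proof.
move=> /andP[st1 t1t].
have [i E] := ray_exp_integral t1 c0 Na0.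
have iD := zero_integral_integrable.
have cq : continuous (fun x => D x - a * expR (c * x)).
  move=> x; apply: cvgB; first exact: mD.
  apply: cvgM; first exact: cvg_cst.
  exact: is_derive_continuous (is_derive_expRM c x).
(* Opening the interval at t1 makes it disjoint from [s, t1], as the pointwise bound requires. *)
rewrite -Rintegral_itv_obnd_cbnd; last first.
  apply: (integrableS _ _ _ (continuous_itv_integrable t1 t mD)) => //.
  by move=> x /=; rewrite !in_itv/= => /andP[/ltW -> ->].
have i1 : mu.-integrable setT (EFin \o (D \_ `]t1, t])).
  rewrite -restrict_EFin -integrable_mkcond//.
  exact: (integrableS _ _ _ iD).
have i2 := itv_integrable s t1 cq.
rewrite [X in X + _ <= _]Rintegral_mkcond [X in _ + X <= _]Rintegral_mkcond.
rewrite -RintegralD// -E.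
have -> : (\int[mu]_x ray_exp c t1 (- a) x)%R = (\int[mu]_x (D x + ray_exp c t1 (- a) x))%R.
  by rewrite RintegralD// [X in _ = X + _]/Rintegral D0 add0r.
apply: le_Rintegral => //.
- exact: (integrableD _ i1 i2).
- exact: (integrableD _ iD i).
move=> x _; rewrite !patchE /ray_exp.
have [xt|xt] := leP x t1.
  rewrite (memNset (A := `]t1, t]%classic)); last by rewrite /= in_itv/= ltNge xt.
  rewrite add0r mulNr; case: ifP => // _.
  by rewrite subr_ge0.
rewrite (memNset (A := `[s, t1]%classic)); last by rewrite /= in_itv/= [x <= _]leNgt xt andbF.
by rewrite !addr0; case: ifP => // _; exact: Dt1.
Qed.

(** Add the nonnegative integral of D' - D to the left-hand side. The resulting integrand is at most
    k e^{(2 + c) x} before t, by the upper bound on D' together with [Da], and vanishes after t. *)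
Lemma zero_integral_compare (t k : R) (D' : R -> R) : 0 <= k ->
  measurable_fun setT D' -> (forall x, t < x -> D' x = D x) ->
  (forall x, x <= t ->
    a * expR (c * x) <= D' x <= a * expR (c * x) + k * expR ((2 + c) * x)) ->
  (0 <= \int[mu]_x (D' x)%:E)%E ->
  forall s, s < t -> (\int[mu]_(x in `[s, t]) (D x - a * expR (c * x)))%R <=
    k * expR ((2 + c) * t) / (2 + c).
Proof.
move=> k0 mD'' DD Db D'0 s st.
have c20 : 0 < 2 + c by rewrite addr_gt0.
have [ia _] := ray_exp_integral t c0 Na0.
have [ik <-] := ray_exp_integral t c20 k0.
have iD := zero_integral_integrable.
have iD' : mu.-integrable setT (EFin \o D').
  apply: (@le_integrable _ _ _ mu _ measurableT _
    (fun x => (`|D x| + ray_exp c t (- a) x + ray_exp (2 + c) t k x)%:E)).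
  - exact/measurable_EFinP.
  - move=> x _; rewrite lee_fin /ray_exp.
    have [xt|xt] := leP x t; last by rewrite !addr0 DD// normr_id.
    have /andP[h1 h2] := Db _ xt.
    have : 0 <= - a * expR (c * x) by rewrite mulr_ge0// expR_ge0.
    have : 0 <= k * expR ((2 + c) * x) by rewrite mulr_ge0// expR_ge0.
    have := normr_ge0 (D x).
    move: h1 h2; rewrite mulNr; set p := a * _; set q := k * _.
    move=> h1 h2 h3 h4 h5.
    rewrite [leRHS]ger0_norm; last by lra.
    by rewrite ler_norml; apply/andP; split; lra.
  - exact: (integrableD _ (integrableD _ (integrable_abse iD) ia) ik).
have cq : continuous (fun x => D x - a * expR (c * x)).
  move=> x; apply: cvgB; first exact: mD.
  apply: cvgM; first exact: cvg_cst.
  exact: is_derive_continuous (is_derive_expRM c x).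
have iq := itv_integrable s t cq.
rewrite [X in X <= _]Rintegral_mkcond.
have E : (\int[mu]_x (D' x - D x))%R = fine (\int[mu]_x (D' x)%:E)%E.
  by rewrite RintegralB// [X in _ - X]/Rintegral D0 subr0.
apply: (@le_trans _ _ ((\int[mu]_x (D' x - D x))%R +
    (\int[mu]_x ((fun x => (D x - a * expR (c * x))%R) \_ `[s, t]) x)%R)).
  by rewrite lerDr E fine_ge0.
rewrite -RintegralD//; last exact: (integrableB _ iD' iD).
apply: le_Rintegral => //.
  exact: (integrableD _ (integrableB _ iD' iD) iq).
move=> x _; rewrite patchE /ray_exp.
have [xt|xt] := leP x t.
  have /andP[h1 h2] := Db _ xt.
  have := Da x; case: ifP => _; first by lra.
  by rewrite (_ : point = 0 :> R)//; lra.
rewrite memNset; last by rewrite /= in_itv/= [x <= _]leNgt xt andbF.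
by rewrite DD// subrr addr0.
Qed.

End zero_integral.

(** * The travelling wave *)

Section energy.
Context {R : realType} (S : setting R).
Local Notation mu := (@lebesgue_measure R).

(** Replaces the chosen [wderiv] by the explicit derivative under the integral, where equality
    almost everywhere suffices. Taking both branches equal covers the profile itself. *)
Lemma energy_piecewise (c t0 : R) (u1 u2 g1 g2 : R -> spL S) (e : R -> R) :
  (forall t, is_derive t (1 : R) u1 (g1 t)) ->
  (forall t, is_derive t (1 : R) u2 (g2 t)) ->
  continuous g1 -> continuous g2 -> u1 t0 = u2 t0 ->
  measurable_fun setT e -> (forall t, calE S (piecewise t0 u1 u2 t) = (e t)%:E) ->
  energy c setT (piecewise t0 u1 u2) =
  (\int[mu]_t ((2^-1 * `|piecewise t0 g1 g2 t| ^+ 2 + e t) * expR (c * t))%:E)%E.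
Proof.
move=> d1 d2 c1 c2 u12 me eE.
have ipE := @ipLE _ S.
have mexp : measurable_fun setT (fun t : R => expR (c * t)).
  apply: continuous_measurable_fun => t.
  exact: is_derive_continuous (is_derive_expRM c t).
have mg g : strongly_measurable setT g ->
    measurable_fun setT (fun t : R => (2^-1 * `|g t : spL S| ^+ 2 + e t) * expR (c * t)).
  move=> sg; apply: measurable_funM => //; apply: measurable_funD => //.
  apply: measurable_funM => //.
  exact: (strongly_measurable_comp (@continuous_sqr_norm _ _) sg).
have mw := wderiv_strongly_measurable ipE d1 d2 c1 c2 u12.
rewrite /energy.
transitivity (\int[mu]_t ((2^-1 * `|wderiv (ipL S) setT (piecewise t0 u1 u2) t| ^+ 2 + e t)
    * expR (c * t))%:E)%E.
  by apply: eq_integral => t _; rewrite /density eE -EFinD -EFinM.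
apply: ae_eq_integral => //.
- by apply/measurable_EFinP; exact: mg.
- by apply/measurable_EFinP; apply: mg; exact: piecewise_strongly_measurable.
have := piecewise_wderiv ipE d1 d2 c1 c2 u12.
apply: filterS; first exact: (ae_filter_ringOfSetsType mu).
by move=> t h _; rewrite h.
Qed.

Lemma piecewise_id (V : normedModType R) (u : R -> V) t0 : piecewise t0 u u = u.
Proof. by apply/funext => t; rewrite /piecewise if_same. Qed.

Lemma tube_closed (V : normedModType R) (F : set V) (r : R) (v : V) :
  (forall eps, 0 < eps -> exists2 w, tube F r w & `|v - w| <= eps) -> tube F r v.
Proof.
move=> h; rewrite /tube/=; apply/lee_addgt0Pr => eps e0.
have [w wr vw] := h _ (divr_gt0 e0 (ltr0Sn _ 1)).
have : (dist w F < (r + eps / 2)%:E)%E.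
  by apply: le_lt_trans wr _; rewrite lte_fin ltrDl divr_gt0.
move=> /ereal_inf_lt[_ [f Ff <-]]; rewrite lte_fin => wf.
apply: (@le_trans _ _ (`|v - f|)%:E); first by apply: ereal_inf_lbound; exists f.
rewrite -EFinD lee_fin.
have -> : v - f = (v - w) + (w - f) by rewrite addrA subrK.
apply: le_trans (ler_normD _ _) _; lra.
Qed.

Lemma tube_le (V : normedModType R) (F : set V) (r r' : R) (v : V) : r <= r' ->
  tube F r v -> tube F r' v.
Proof. by move=> rr' h; apply: le_trans h _; rewrite lee_fin. Qed.

Lemma tube_point (V : normedModType R) (F : set V) (r : R) (v f : V) : F f ->
  `|v - f| <= r -> tube F r v.
Proof.
move=> Ff vf; apply: (@le_trans _ _ (`|v - f|)%:E); last by rewrite lee_fin.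
by apply: ereal_inf_lbound; exists f.
Qed.

End energy.

Lemma is_derive_scalel (R : realType) (V : normedModType R) (f : R -> R) (y : V) t df :
  is_derive t (1 : R) f df -> is_derive t (1 : R) (fun s => f s *: y) (df *: y).
Proof.
move=> [/cvg_ex[l /= hl] dl].
have {dl} e : l = df by rewrite -dl; apply/esym/cvg_lim.
subst l.
have key : h^-1 *: (f (h *: 1 + t) *: y - f t *: y) @[h --> (0:R)^'] --> df *: y.
  apply: cvg_trans (cvgZr_tmp (a := y) hl).
  by apply: near_eq_cvg; near=> h; rewrite /= -scalerBl scalerA.
split; first by apply/cvg_ex; eexists; exact: key.
exact/cvg_lim.
Unshelve. all: by end_near. Qed.

(** * The chain rule in H and the Hamiltonian identity *)

Section regular.
Context {R : realType} (S : setting R).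
Local Notation L := (spL S).
Local Notation H := (spH S).
Hypothesis h2 : hypH2 S.
Variables (c : R) (U : R -> L).
Hypothesis (hreg : regular setT U) (hsol : solves c setT U).

Lemma regular_is_derive t : is_derive t (1 : R) U (derive1 U t).
Proof.
have [[[dU _] _] _ _] := hreg.
by rewrite derive1E; apply: derivableP; exact: dU.
Qed.

Lemma regular_is_derive2 t : is_derive t (1 : R) (derive1 U) (derive1n 2 U t).
Proof.
have [[_ [dU _]] _ _] := hreg.
by rewrite /= derive1E; apply: derivableP; exact: dU.
Qed.

Lemma regular_continuous_derive1 : continuous (derive1 U).
Proof. by have [[[_ cU] _] _ _] := hreg; move=> t; apply: cU; rewrite inE. Qed.

(** The [fine] in [EH] loses nothing: by (H2) the energy is < +oo on the range of the inclusion, and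
    it is never -oo. *)
Lemma calE_iota (h : H) : calE S (Defs.iota S h) = (EH h)%:E.
Proof.
have [rg _ _ _ _] := h2.
have : range (Defs.iota S) (Defs.iota S h) by exists h.
rewrite rg /= => lty; rewrite /EH fineK// fin_numE -ltey lty andbT.
by rewrite gt_eqF// calE_gtNy.
Qed.

Lemma EH_differentiable (h : H) : differentiable (@EH _ S) h.
Proof.
by have [_ _ [f' [_ + _]] _ _] := h2; rewrite interiorT => /(_ h I)[].
Qed.

Lemma EH_continuous : continuous (@EH _ S).
Proof. by move=> h; apply: differentiable_continuous; exact: EH_differentiable. Qed.

Lemma iota_continuous : continuous (Defs.iota S).
Proof.
have [_ le _ _ _] := h2.
move=> h; apply/cvgrPdist_lt => e e0; near=> k.
rewrite -linearB; apply: le_lt_trans (le _) _.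
by near: k; apply: cvgr_dist_lt => //; exact: cvg_id.
Unshelve. all: by end_near. Qed.

Lemma iota_is_derive (u : R -> H) t du : is_derive t (1 : R) u du ->
  is_derive t (1 : R) (Defs.iota S \o u) (Defs.iota S du).
Proof.
move=> [/cvg_ex[l /= hl] dl].
have {dl} e : l = du by rewrite -dl; apply/esym/cvg_lim.
subst l.
have key : h^-1 *: ((Defs.iota S \o u) (h *: 1 + t) - (Defs.iota S \o u) t)
    @[h --> (0:R)^'] --> Defs.iota S du.
  apply: cvg_trans (cvg_comp _ _ hl (@iota_continuous du)).
  by apply: near_eq_cvg; near=> h; rewrite /= linearZ linearB.
split; first by apply/cvg_ex; eexists; exact: key.
exact/cvg_lim.
Unshelve. all: by end_near. Qed.

Variable Uh : R -> H.
Hypothesis (UhE : forall t, Defs.iota S (Uh t) = U t) (C1Uh : C1_curve setT Uh).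

(** The chain rule in H gives DE(U)(U') = <D_L E(U), U'>, and the equation replaces the gradient by
    U'' + c U'. The point of [Ht] supplied by [solves] is [Uh t], because the inclusion of H in L is
    injective. *)
Lemma energy_is_derive t : is_derive t (1 : R) (fun s => EH (Uh s) : R)
  (ipL S (derive1n 2 U t + c *: derive1 U t) (derive1 U t)).
Proof.
have [_ _ _ _ [_ gradE]] := h2.
have [dUh _] := C1Uh.
have dUht : is_derive t (1 : R) Uh (derive1 Uh t).
  by rewrite derive1E; apply: derivableP; exact: dUh.
have [x xU eq] := @hsol t I.
have xUh : iotat S x = Uh t by apply: (@iota_inj _ S); rewrite xU UhE.
have iU1 : Defs.iota S (derive1 Uh t) = derive1 U t.
  have := iota_is_derive dUht; rewrite (_ : Defs.iota S \o Uh = U); last first.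
    by apply/funext => s; rewrite /= UhE.
  by move=> [_ <-]; rewrite derive1E.
have dUh' : differentiable Uh t by apply/derivable1_diffP; exact: dUh.
have dcomp : differentiable (@EH _ S \o Uh) t.
  by apply: differentiable_comp => //; exact: EH_differentiable.
have grad : derive1n 2 U t + c *: derive1 U t = gradL S x.
  by move/eqP: eq; rewrite subr_eq => /eqP ->; rewrite addrAC addNr add0r.
rewrite grad -iU1 gradE xUh.
have -> : ('d (@EH _ S) (Uh t) : H -> R^o) (derive1 Uh t) = derive1 (@EH _ S \o Uh) t.
  rewrite (derive1E' dcomp) diff_comp//; last exact: EH_differentiable.
  by rewrite /= -derive1E'.
rewrite derive1E; apply: derivableP.
exact/derivable1_diffP.
Qed.

Lemma hamiltonian_is_derive t : is_derive t (1 : R)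
  (fun s => EH (Uh s) - 2^-1 * `|derive1 U s| ^+ 2) (c * `|derive1 U t| ^+ 2).
Proof.
have d1 := energy_is_derive t.
have d2 := is_derive_dot (@ipLE _ S) (regular_is_derive2 t) (regular_is_derive2 t).
rewrite (_ : (fun s => _) =
    (fun s => EH (Uh s) - 2^-1 * ipL S (derive1 U s) (derive1 U s))); last first.
  by apply/funext => s; rewrite ipLE.
apply: is_derive_eq; rewrite /GRing.scale/=.
rewrite dotDl dotZl -[X in _ = c * X](@ipLE _ S) (dotC _ (derive1 U t) (derive1n 2 U t)).
by field.
Qed.

End regular.

(** * The profile: last exit time, competitor, limit at -oo *)

Section front.
Context {R : realType} (S : setting R).
Local Notation mu := (@lebesgue_measure R).
Local Notation L := (spL S).
Local Notation H := (spH S).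
Local Notation a := (alevel S).
Local Notation F := (calF S).
Local Notation r0 := (rad0 S).
Local Notation C := (Ccst S minus).
Local Notation rhat := (rhat_minus S).
Local Notation b := (Defs.beta S minus rhat).
Local Notation gamma := (gamma_minus S).
Hypotheses (h1 : hypH1 S) (h2 : hypH2 S) (h5 : hypH5 S) (h7 : hypH7 S).

Lemma rad0_gt0 s : 0 < r0 s.
Proof. by have [_ _ _ _ []] := h1. Qed.

Lemma Ccst_gt1 s : 1 < Ccst S s.
Proof. by have [_ _ _ _ [_ _ /(_ s)[]]] := h1. Qed.

Lemma rhat_gt0 : 0 < rhat.
Proof. by rewrite divr_gt0 ?rad0_gt0// addr_gt0// (lt_trans ltr01)// Ccst_gt1. Qed.

Lemma rhat_le_half : rhat <= r0 minus / 2.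
Proof.
rewrite ler_pM2l ?rad0_gt0// lef_pV2 ?posrE//; last first.
  by rewrite addr_gt0// (lt_trans ltr01)// Ccst_gt1.
have := Ccst_gt1 minus; lra.
Qed.

Lemma half_le_rad0 s : r0 s / 2 <= r0 s.
Proof. have := rad0_gt0 s; lra. Qed.

Lemma rhat_le_rad0 : rhat <= r0 minus.
Proof. exact: le_trans rhat_le_half (half_le_rad0 _). Qed.

Lemma beta_rhat : 0 < b /\ forall h : H, FL minus (r0 minus) (Defs.iota S h) ->
  EH h <= a + b -> FH minus rhat h.
Proof.
have [_ _ _ _ /(_ rhat)] := h5 minus.
rewrite rhat_gt0 rhat_le_rad0 => /(_ isT)[b0 hb]; split => // h hF hE.
have [|k kF /iota_inj <- //] := hb _ hF.
by rewrite (calE_iota h2) lee_fin.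
Qed.

(** By (H7), - a < p b, and p <= 1 since C > 1. *)
Lemma level_beta_gt0 : 0 < a + b.
Proof.
have [b0 _] := beta_rhat.
have [+ _] := h7.
set p := (C ^+ 2 * (C + 1))^-1.
have C1 := Ccst_gt1 minus.
have C0 : 0 < C := lt_trans ltr01 C1.
have p0 : 0 < p by rewrite invr_gt0 mulr_gt0 ?exprn_gt0 ?addr_gt0.
have p1 : p <= 1.
  rewrite invf_le1 ?mulr_gt0 ?exprn_gt0 ?addr_gt0//.
  by rewrite -[leLHS]mulr1 ler_pM// ?exprn_ege1 ?ltW//; lra.
rewrite /Emax_minus -/p => lt.
have : ((- a)%:E < p%:E * b%:E)%E.
  apply: lt_le_trans lt _.
  by rewrite lee_pmul2l ?lte_fin// !ge_min lexx !orbT.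
rewrite -EFinM lte_fin => lt'.
have : p * b <= b by rewrite ler_piMl// ltW.
lra.
Qed.

Lemma gamma_gt0 : 0 < gamma.
Proof.
have C0 : 0 < C := lt_trans ltr01 (Ccst_gt1 minus).
by rewrite invr_gt0 addr_gt0// /sfC_minus !mulr_gt0 ?exprn_gt0 ?addr_gt0 ?exprn_gt0 ?addr_gt0.
Qed.

Local Notation K := (2^-1 * (2^-1 + C ^+ 2) * C ^+ 2).

(** K <= [sfC_minus] because 1/2 <= (C + 1)^2, and 1 / gamma is C + [sfC_minus]. *)
Lemma gammaK : gamma * K <= 1.
Proof.
have C1 := Ccst_gt1 minus.
have C0 : 0 < C by apply: lt_trans C1.
have s0 : 0 <= (C + 1) ^+ 2 by rewrite sqr_ge0.
have s1 : 1 <= (C + 1) ^+ 2 by rewrite exprn_ege1//; lra.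
have := gamma_gt0; rewrite /gamma_minus invr_gt0 => g0.
rewrite mulrC ler_pdivrMr// mul1r /sfC_minus.
have : C ^+ 2 * 1 <= C ^+ 2 * (C + 1) ^+ 2 by rewrite ler_pM2l ?exprn_gt0.
have : 0 <= C ^+ 2 by rewrite sqr_ge0.
set x := C ^+ 2; set y := (C + 1) ^+ 2; lra.
Qed.

Variables (c : R) (U : R -> L).
Hypothesis (hU : existence_solution c U).

Let c0 : 0 < c. Proof. by have [] := hU. Qed.
Let hreg : regular setT U. Proof. by have [_ []] := hU. Qed.
Let hsol : solves c setT U. Proof. by have [_ _] := hU. Qed.

Variable Uh : R -> H.
Hypothesis (UhE : forall t, Defs.iota S (Uh t) = U t) (C1Uh : C1_curve setT Uh).

Local Notation U1 := (derive1 U).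
Local Notation e := (fun t => EH (Uh t) : R).
Local Notation W := (wexcess U1 e a c).

Let dU := regular_is_derive hreg.
Let cU1 := regular_continuous_derive1 hreg.
Let de := hamiltonian_is_derive h2 hreg hsol UhE C1Uh.

Lemma calE_profile t : calE S (U t) = (e t)%:E.
Proof. by rewrite -UhE (calE_iota h2). Qed.

Lemma profile_near_minus : exists T0, forall t, t <= T0 -> FL minus (r0 minus / 2) (U t).
Proof.
have [_ _ _ [[A [_ hA]] _] _] := hU.
by exists (A - 1) => t tA; apply: hA; apply: le_lt_trans tA _; rewrite ltrBlDr ltrDl.
Qed.

(** (H1) states the bound a <= E in the presence of a point of F^-; projecting the profile near -oo
    provides one. *)
Lemma calF_minus_nonempty : exists f, F minus f.
Proof.
have [T0 hT0] := profile_near_minus.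
have [_ _ _ _ [_ _ _ hP _]] := h1.
have /hP[Ff _ _] := tube_le (half_le_rad0 minus) (hT0 _ (lexx _)).
by eexists; exact: Ff.
Qed.

Lemma level_le_calE v : (a%:E <= calE S v)%E.
Proof.
have [f Ff] := calF_minus_nonempty.
by have [_ _ [_ /(_ v f Ff)[]]] := h1.
Qed.

Lemma level_le t : a <= e t.
Proof. by rewrite -lee_fin -calE_profile level_le_calE. Qed.

Lemma level_lt0 : a < 0.
Proof. by have [_ _ []] := h1. Qed.

Lemma FL_disjoint (v : L) : FL plus (r0 plus / 2) v -> FL minus (r0 minus / 2) v -> False.
Proof.
move=> vp vm; have [_ _ _ _ [_ dis _ _ _]] := h1.
suff : set0 v by [].
by rewrite -dis; split; exact: tube_le (half_le_rad0 _) _.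
Qed.

(** The supremum of the times spent in the tube around F^- is finite because the two tubes are
    disjoint, and it is attained because the tube is closed. Afterwards, (H7) excludes negative
    energy. *)
Lemma last_exit : exists t1, FL minus (r0 minus / 2) (U t1) /\
  forall t, t1 < t -> 0 <= e t.
Proof.
pose A := [set t | FL minus (r0 minus / 2) (U t)].
have [T0 hT0] := profile_near_minus.
have [_ _ _ [_ [B [_ hB]]] _] := hU.
have A0 : A !=set0 by exists T0; exact: hT0.
have Aub : ubound A B.
  by move=> t At; rewrite leNgt; apply/negP => /hB Bt; exact: FL_disjoint Bt At.
have supA : has_sup A by split => //; exists B.
exists (sup A); split.
  apply: tube_closed => eps eps0.
  have /cvgrPdist_le/(_ _ eps0) := is_derive_continuous (dU (sup A)).
  move=> /nbhs_ballP[d /= d0 hd].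
  have [t At] := sup_adherent d0 supA.
  rewrite ltrBlDr => st.
  have ts : t <= sup A by exact: (sup_upper_bound supA).
  exists (U t) => //; apply: hd.
  by rewrite /ball/= ger0_norm ?subr_ge0//; lra.
move=> t st; rewrite leNgt; apply/negP => et.
have [_ h] := h7.
have : A t by rewrite /A/= -UhE; apply: h; rewrite (calE_iota h2) lte_fin.
by move=> /(sup_upper_bound supA); rewrite leNgt st.
Qed.

Local Notation D := (fun t => (2^-1 * `|U1 t| ^+ 2 + e t) * expR (c * t)).

Lemma continuous_energy : continuous e.
Proof.
have [dUh _] := C1Uh.
move=> t; have cUh : {for t, continuous Uh}.
  by apply: differentiable_continuous; apply/derivable1_diffP; exact: dUh.
exact: (cvg_comp _ _ cUh (EH_continuous h2 (x := Uh t))).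
Qed.

Lemma continuous_density : continuous D.
Proof.
move=> t; apply: cvgM; last exact: is_derive_continuous (is_derive_expRM c t).
apply: cvgD; last exact: continuous_energy.
apply: cvgM; first exact: cvg_cst.
exact: (cvg_comp _ _ (@cU1 t) (@continuous_sqr_norm _ _ _)).
Qed.

Lemma energy_profile : (\int[mu]_t (D t)%:E = 0)%E.
Proof.
have [_ _ _ _ [[_ <-] _ _ _]] := hU.
have := @energy_piecewise _ S c 0 U U U1 U1 e dU dU cU1 cU1 (erefl _).
rewrite !piecewise_id => -> //.
- by apply: continuous_measurable_fun; exact: continuous_energy.
- exact: calE_profile.
Qed.

Lemma density_ge t : a * expR (c * t) <= D t.
Proof.
rewrite ler_pM2r ?expR_gt0//; have := level_le t.
have := sqr_ge0 `|U1 t|; lra.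
Qed.

Lemma Rintegral_is_derive (f G : R -> R) (s t : R) : s < t -> continuous f ->
  (forall x, is_derive x (1 : R) G (f x)) -> (\int[mu]_(x in `[s, t]) f x)%R = G t - G s.
Proof. by move=> st cf dG; rewrite /Rintegral (integral_is_derive st cf dG). Qed.

Lemma integral_wexcess (s t : R) : s < t ->
  (\int[mu]_(x in `[s, t]) (D x - a * expR (c * x)))%R = W t - W s.
Proof.
move=> st; apply: Rintegral_is_derive => //.
  move=> x; apply: cvgB; first exact: continuous_density.
  apply: cvgM; first exact: cvg_cst.
  exact: is_derive_continuous (is_derive_expRM c x).
move=> x; apply: (is_derive_eq (is_derive_wexcess a c0 de x)).
by rewrite -mulrBl.
Qed.

Lemma budget t1 : (forall t, t1 < t -> 0 <= e t) -> forall s t, s < t1 < t ->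
  W t + a / c * expR (c * t) - (W t1 + a / c * expR (c * t1)) +
  (W t1 - W s) <= - a * expR (c * t1) / c.
Proof.
move=> et1 s t st; have /andP[st1 t1t] := st.
have Dt1 x : t1 < x -> 0 <= D x.
  move=> xt; rewrite mulr_ge0 ?expR_ge0// addr_ge0 ?et1//.
have := zero_integral_split (ltW level_lt0) c0 continuous_density density_ge energy_profile Dt1 st.
rewrite integral_wexcess//.
suff -> : (\int[mu]_(x in `[t1, t]) D x)%R =
  W t + a / c * expR (c * t) - (W t1 + a / c * expR (c * t1)) by [].
apply: (@Rintegral_is_derive _ (fun x => W x + a / c * expR (c * x))) => //.
  exact: continuous_density.
move=> x.
have ? := is_derive_wexcess a c0 de x.
have ? := is_derive_expRM c x.
apply: is_derive_eq; rewrite /GRing.scale/=.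
by have cN0 := lt0r_neq0 c0; field.
Qed.

(** Put theta = e^{x - t} and w = U(t) - p. For x <= t the competitor has speed at most theta |w|,
    and energy at most a + C^2 theta^2 |w|^2 by (H5). Its density thus exceeds a e^{cx} by at most
    (1/2 + C^2) theta^2 |w|^2 e^{cx}, and |w|^2 <= C^2 (e(t) - a). *)
Lemma energy_comparison T0 : (forall t, t <= T0 -> FL minus (r0 minus / 2) (U t)) ->
  forall t, t <= T0 -> e t <= a + b -> forall s, s < t ->
  W t - W s <= K * (e t - a) * expR (c * t).
Proof.
move=> hT0 t tT0 etb s st.
have [b0 hb] := beta_rhat.
(* The radius [rhat] is at most r0 / 2, which keeps the competitor both in the H-tube where (H5)
   applies and in the L-tube required by [admissible]. *)
have Urhat : FH minus rhat (Uh t).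
  apply: hb => //; rewrite UhE; exact: tube_le (half_le_rad0 _) (hT0 _ tT0).
have Ur0 : FH minus (r0 minus) (Uh t) := tube_le rhat_le_rad0 Urhat.
have [hPH _ _ hE _] := h5 minus.
have [Fp dp _] := hPH _ Ur0.
have [El _] := hE _ Ur0.
set p := projH S minus (Uh t) in Fp dp El.
pose w := Uh t - p.
have wr : `|w| <= rhat by rewrite -lee_fin dp.
have C1 := Ccst_gt1 minus.
have CN0 : 0 < C ^+ 2 by rewrite exprn_gt0// (lt_trans ltr01).
have wE : `|w| ^+ 2 <= C ^+ 2 * (e t - a).
  move: El; rewrite (calE_iota h2) -EFinB lee_fin -/w.
  by rewrite mulrC ler_pdivrMr// mulrC.
pose th x := expR (x - t).
have th1 x : x <= t -> 0 <= th x <= 1.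
  by move=> xt; rewrite expR_ge0/= -expR0 ler_expR subr_le0.
have dth x : is_derive x (1 : R) th (th x).
  have dx : is_derive x (1 : R) (fun x => x - t) 1.
    by apply: is_derive_eq; rewrite subr0.
  have := @is_derive1_comp R expR (fun x => x - t) x _ _ (is_derive_expR _) dx.
  by rewrite mulr1.
pose q x := p + th x *: w.
pose u1 x : L := Defs.iota S (q x).
pose g1 x : L := th x *: Defs.iota S w.
have dw (V : normedModType R) (y : V) x : is_derive x (1 : R) (fun x => th x *: y) (th x *: y).
  exact: is_derive_scalel (dth x).
have du1 x : is_derive x (1 : R) u1 (g1 x).
  rewrite (_ : u1 = (fun x => Defs.iota S p + th x *: Defs.iota S w)); last first.
    by apply/funext => y; rewrite /u1 linearD linearZ.
  have ? := dw _ (Defs.iota S w) x.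
  by apply: is_derive_eq; rewrite add0r.
have cg1 : continuous g1.
  by move=> x; exact: is_derive_continuous (dw _ (Defs.iota S w) x).
have u1t : u1 t = U t.
  by rewrite /u1 /q /th subrr expR0 scale1r /w addrC subrK UhE.
have qF x : x <= t -> FH minus (th x * `|w|) (q x).
  move=> xt; apply: (tube_point (f := p)) => //.
  by rewrite /q addrC addKr normrZ ger0_norm// expR_ge0.
have qr0 x : x <= t -> FH minus (r0 minus) (q x).
  move=> xt; apply: tube_le (qF _ xt).
  apply: le_trans rhat_le_rad0; apply: le_trans wr.
  by rewrite ler_piMl//; have /andP[] := th1 _ xt.
(* Whatever the projection of [q x] is, the point p of F^- already bounds its distance by theta |w|,
   and (H5) bounds the energy by that distance. *)
have Eq x : x <= t -> EH (q x) <= a + C ^+ 2 * `|w| ^+ 2 * th x ^+ 2.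
  move=> xt; have [_ Eu] := hE _ (qr0 _ xt).
  have [_ dq _] := hPH _ (qr0 _ xt).
  have : `|q x - projH S minus (q x)| <= th x * `|w| by rewrite -lee_fin dq; exact: qF.
  move: Eu; rewrite (calE_iota h2) -EFinB lee_fin /=.
  set z := `|q x - _| => Eu zq.
  have : C ^+ 2 * z ^+ 2 <= C ^+ 2 * (th x * `|w|) ^+ 2.
    by rewrite ler_pM2l// ler_sqr ?nnegrE ?mulr_ge0 ?expR_ge0 ?normr_ge0.
  rewrite exprMn; move: Eu; rewrite (mulrC (th x ^+ 2)) mulrA; lra.
pose V := piecewise t u1 U.
pose eV x := if x <= t then EH (q x) else e x.
have EV x : calE S (V x) = (eV x)%:E.
  rewrite /V /piecewise /eV; case: ifP => _; first exact: (calE_iota h2).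
  exact: calE_profile.
have ceq : continuous (fun x => EH (q x)).
  move=> x; have cq : {for x, continuous q}.
    by apply: cvgD; [exact: cvg_cst|exact: is_derive_continuous (dw _ w x)].
  exact: (cvg_comp _ _ cq (EH_continuous h2 (x := q x))).
have meV : measurable_fun setT eV.
  apply: (@measurable_piecewise _ (fun x => EH (q x)) e).
    exact: continuous_measurable_fun.
  by apply: continuous_measurable_fun; exact: continuous_energy.
have admV : admissible V.
  split; first exact: (piecewise_H1loc (@ipLE _ S) du1 dU cg1 cU1 u1t).
  have [_ [_ [_ [T T1 [Tp _]]]] _ _ _] := hU.
  (* Beyond |t| + 1, the curve V is U on the right and the exponential profile on the left. *)
  exists (Num.max T (`|t| + 1)); first by rewrite le_max T1.
  split=> x.
    rewrite ge_max => /andP[Tx tx]; rewrite /V /piecewise ifF; first exact: Tp.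
    by apply/negbTE; rewrite -ltNge; have := ler_norm t; lra.
  rewrite lerNr ge_max => /andP[_ tx]; rewrite /V /piecewise ifT; last first.
    by have := ler_norm (- t); rewrite normrN; lra.
  have xt : x <= t by have := ler_norm (- t); rewrite normrN; lra.
  apply: (tube_point Fp).
  rewrite /u1 /q linearD addrC addKr linearZ normrZ ger0_norm ?expR_ge0//.
  have [_ iota_le _ _ _] := h2.
  apply: le_trans rhat_le_half; apply: le_trans wr.
  apply: le_trans (iota_le w).
  by rewrite ler_piMl//; have /andP[] := th1 _ xt.
pose D' x := (2^-1 * `|piecewise t g1 U1 x| ^+ 2 + eV x) * expR (c * x).
have D'0 : (0 <= \int[mu]_x (D' x)%:E)%E.
  have [_ _ _ _ [[minU U0] _ _ _]] := hU.
  have := minU _ admV.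
  by rewrite U0; have -> := @energy_piecewise _ S c t u1 U g1 U1 eV du1 dU cg1 cU1 u1t meV EV.
(* The factor e^{-2t} comes from theta^2 = e^{2 (x - t)}. *)
pose k := (2^-1 + C ^+ 2) * `|w| ^+ 2 * expR (- 2 * t).
have k0 : 0 <= k.
  by rewrite mulr_ge0 ?expR_ge0// mulr_ge0 ?sqr_ge0// addr_ge0// ltW.
have [t1 [_ et1]] := last_exit.
have Dt1 x : t1 < x -> 0 <= D x.
  by move=> xt; rewrite mulr_ge0 ?expR_ge0// addr_ge0 ?et1.
have mD' : measurable_fun setT D'.
  apply: measurable_funM.
    apply: measurable_funD => //; apply: measurable_funM => //.
    apply: (strongly_measurable_comp (@continuous_sqr_norm _ _)).
    exact: piecewise_strongly_measurable.
  apply: continuous_measurable_fun => x.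
  exact: is_derive_continuous (is_derive_expRM c x).
have := @zero_integral_compare _ a c D (ltW level_lt0) c0 continuous_density density_ge
  energy_profile t1 Dt1 t k D' k0 mD' _ _ D'0 s st.
rewrite integral_wexcess// => key.
apply: le_trans (key _ _) _.
- move=> x tx; rewrite /D' /piecewise /eV.
  by rewrite ifF; [rewrite ifF//|]; apply/negbTE; rewrite -ltNge.
- move=> x xt; rewrite /D' /piecewise /eV xt.
  have E0 := expR_gt0 (c * x).
  apply/andP; split.
    rewrite ler_pM2r//.
    have : a <= EH (q x) by rewrite -lee_fin -(calE_iota h2) level_le_calE.
    have := sqr_ge0 `|g1 x|; lra.
  have -> : k * expR ((2 + c) * x) = (2^-1 + C ^+ 2) * `|w| ^+ 2 * th x ^+ 2 * expR (c * x).
    rewrite /k -[LHS]mulrA -expRD /th [expR (x - t) ^+ 2]expr2.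
    rewrite -[expR (x - t) * _]expRD -[RHS]mulrA -expRD.
    congr (_ * expR _).
    by ring.
  rewrite -mulrDl ler_pM2r//.
  have := Eq _ xt.
  have : `|g1 x| ^+ 2 <= `|w| ^+ 2 * th x ^+ 2.
    rewrite /g1 normrZ exprMn ger0_norm ?expR_ge0// mulrC ler_wpM2r ?sqr_ge0//.
    have [_ iota_le _ _ _] := h2.
    by rewrite ler_sqr ?nnegrE ?normr_ge0.
  set y := `|w| ^+ 2; set z := th x ^+ 2; set v := `|g1 x| ^+ 2; lra.
have -> : k * expR ((2 + c) * t) = (2^-1 + C ^+ 2) * `|w| ^+ 2 * expR (c * t).
  rewrite /k -mulrA -expRD; by congr (_ * expR _); ring.
have hw : (2^-1 + C ^+ 2) * `|w| ^+ 2 <= (2^-1 + C ^+ 2) * (C ^+ 2 * (e t - a)).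
  by rewrite ler_wpM2l// addr_ge0// ltW.
(* Bounding 1 / (2 + c) by 1/2 gives the outer factor of K. *)
rewrite ler_pdivrMr ?addr_gt0//.
apply: (@le_trans _ _ (K * (e t - a) * expR (c * t) * 2)).
  have -> : K * (e t - a) * expR (c * t) * 2 =
      (2^-1 + C ^+ 2) * (C ^+ 2 * (e t - a)) * expR (c * t) by field.
  by rewrite ler_pM2r ?expR_gt0.
apply: ler_wpM2l; last by rewrite lerDl ltW.
rewrite mulr_ge0 ?expR_ge0// mulr_ge0//; last by rewrite subr_ge0 level_le.
by rewrite mulr_ge0 ?(ltW CN0)// mulr_ge0// addr_ge0// ltW.
Qed.

Local Notation nu := (gamma - c).

Lemma profile_limit :
  - a < (d0 S * gamma) ^+ 2 / 2 ->
  c < gamma /\ exists (M : R) (v : L), [/\ 0 < M, F minus v &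
    forall t : R, `|U t - v| <= M * expR (nu * t)].
Proof.
move=> ha.
have [t1 [Ut1 et1]] := last_exit.
have bud := budget et1.
have [_ _ _ [_ [B [_ hB]]] [_ _ _ [Mp [vp [Mp0 _ hvp]]]]] := hU.
have cg : c < gamma.
  (* At t1 the profile is in the tube around F^-, and at t2 in the one around F^+, so these two
     points are at least [d0] apart. *)
  pose t2 := Num.max t1 B + 1.
  have t12 : t1 < t2 by rewrite (@le_lt_trans _ _ (Num.max t1 B)) ?ltrDl// le_max lexx.
  have Bt2 : B < t2 by rewrite (@le_lt_trans _ _ (Num.max t1 B)) ?ltrDl// le_max lexx orbT.
  have speed := speed_bound (@ipLE _ S) c0 dU de level_le et1 bud t12.
  have d00 : 0 <= d0 S.
    apply: lb_le_inf; last by move=> _ [vw _ <-].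
    by exists `|U t2 - U t1|; exists (U t2, U t1) => //; split => //=; exact: hB.
  have d0z : d0 S <= `|U t2 - U t1|.
    apply: ge_inf; first by exists 0 => _ [vw _ <-].
    by exists (U t2, U t1) => //; split => //=; exact: hB.
  rewrite ltNge; apply/negP => gc.
  have : (d0 S * gamma) ^+ 2 <= c ^+ 2 * `|U t2 - U t1| ^+ 2.
    rewrite mulrC -exprMn ler_sqr ?nnegrE ?mulr_ge0 ?(ltW gamma_gt0) ?(ltW c0)//.
    by rewrite ler_pM// ltW// gamma_gt0.
  move: ha speed; set p := _ ^+ 2; set q := c ^+ 2 * _; lra.
split=> //.
have [T0 hT0] := profile_near_minus.
have comp := energy_comparison hT0.
have n0 : 0 < nu by rewrite subr_gt0.
have [T _ [M M0 hM]] := profile_cauchy_near_Ny (@ipLE _ S) c0 dU de level_le et1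
  bud level_beta_gt0 cg gammaK comp.
have [v hv] := limit_near_Ny n0 M0 hM.
(* F^- is closed, so it suffices to approach v by points of F^-. At a time where E(U) - a is small,
   the coercivity in (H1) puts U close to its projection, and U is also close to v. *)
have Fv : F minus v.
  have [_ clF _ _ [_ _ hC hP _]] := h1.
  have CN0 := Ccst_gt1 minus.
  have C0 : 0 < C by apply: lt_trans CN0.
  have clE : F minus = closure (F minus) by apply/closure_id; exact: clF.
  rewrite clE.
  move=> A /nbhs_ballP[eps /= eps0 hA].
  have e20 : 0 < eps / 2 by rewrite divr_gt0.
  have [s sT sM] := expRM_small T n0 (divr_gt0 e20 M0).
  have [t ts te] := energy_small_near_Ny c0 de level_le et1
    bud level_beta_gt0 cg gammaK comp (Num.min s T0) (divr_gt0 (exprn_gt0 2 e20) C0).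
  move: ts; rewrite le_min => /andP[ts tT0].
  have Ut : FL minus (r0 minus) (U t) := tube_le (half_le_rad0 _) (hT0 _ tT0).
  have [Fp dp _] := hP _ _ Ut.
  have [_ hC'] := hC minus.
  have := hC' _ Ut; rewrite -dp calE_profile -EFin_expe -EFinM -EFinB lee_fin /=.
  rewrite mulrC ler_pdivrMr// => h3.
  have h4 : `|U t - projL S minus (U t)| < eps / 2.
    rewrite -(@ltr_sqr _ `|_|) ?nnegrE ?(ltW e20)//.
    by apply: le_lt_trans h3 _; rewrite -ltr_pdivlMr.
  exists (projL S minus (U t)); split => //; apply: hA.
  rewrite -ball_normE /ball_/=.
  have -> : v - projL S minus (U t) = (U t - projL S minus (U t)) - (U t - v).
    by rewrite opprB [RHS]addrC addrA subrK.
  apply: le_lt_trans (ler_normB _ _) _.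
  have : `|U t - v| <= eps / 2.
    apply: le_trans (hv _ (le_trans ts (ltW sT))) _.
    rewrite mulrC -ler_pdivlMr//; apply: le_trans sM.
    by rewrite ler_expR ler_pM2l.
  lra.
(* After T, the exponential convergence at +oo bounds |U - v| by N; since e^{nu t} >= e^{nu T}
   there, the factor e^{- nu T} turns N into an admissible constant. *)
pose N := Mp * expR (- (c * T)) + `|vp - v|.
have N0 : 0 <= N by rewrite addr_ge0// mulr_ge0 ?expR_ge0// ltW.
exists (M + N * expR (- (nu * T))), v; split => //.
  by rewrite ltr_pwDl// mulr_ge0// expR_ge0.
move=> t; have [tT|Tt] := leP t T.
  apply: le_trans (hv _ tT) _; rewrite ler_pM2r ?expR_gt0// lerDl.
  by rewrite mulr_ge0// expR_ge0.
apply: (@le_trans _ _ N).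
  have -> : U t - v = (U t - vp) + (vp - v) by rewrite addrA subrK.
  apply: le_trans (ler_normD _ _) _; rewrite lerD2r.
  apply: le_trans (hvp _) _.
  by rewrite ler_pM2l// ler_expR lerN2 ler_pM2l// ltW.
rewrite mulrDl -[leLHS]add0r; apply: lerD; first by rewrite mulr_ge0 ?expR_ge0// ltW.
rewrite -mulrA -expRD ler_peMr// -expR0 ler_expR addrC -mulrBr.
by rewrite mulr_ge0// ?subr_ge0 ltW.
Qed.

End front.

Theorem theorem6 (R : realType) (S : setting R)
    (h1 : hypH1 S) (h2 : hypH2 S) (h3 : hypH3 S) (h4 : hypH4 S)
    (h5 : hypH5 S) (h6 : hypH6 S) (h7 : hypH7 S)
    (ha : - alevel S < (d0 S * gamma_minus S) ^+ 2 / 2)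
    (c : R) (U : R -> spL S) (hU : existence_solution c U) :
  c < gamma_minus S /\
  exists (M : R) (v : spL S), [/\ 0 < M, calF S minus v &
    forall t : R, `|U t - v| <= M * expR ((gamma_minus S - c) * t)].
Proof.
have [_ [[_ [Uh UhE C1Uh] _] _] _ _ _] := hU.
exact: (profile_limit h1 h2 h5 h7 hU (fun t => UhE t I) C1Uh ha).
Qed.
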